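(* Let $\Omega$ be a metric space. The $k$-nearest neighbour classifier is universally consistent in $\Omega$ if and only if (i) it is universally consistent in every separable metric subspace of $\Omega$, and (ii) the density of $\Omega$ is strictly less than every real-valued measurable cardinal (condition (ii) holds vacuously if there are no real-valued measurable cardinals).
   Context: Learning setup. For a measurable space $(\Omega,\mathcal A)$, give $\Omega\times\{0,1\}$ the product $\sigma$-algebra. A classifier is a measurable map $T:\Omega\to\{0,1\}$. A learning rule $\mathcal L$ assigns to every $n\ge 1$, every labelled sample $\sigma=(x_1,\dots,x_n,y_1,\dots,y_n)\in\Omega^n\times\{0,1\}^n$ and every $x\in\Omega$ a label $\mathcal L_n(\sigma)(x)\in\{0,1\}$. For a probability measure $\tilde\mu$ on $\Omega\times\{0,1\}$, the error of the rule at sample size $n$ is $\mathrm{err}_{\tilde\mu}(\mathcal L_n)=(\tilde\mu^{n}\otimes\tilde\mu)\{(\sigma,x,y):\mathcal L_n(\sigma)(x)\neq y\}$ (the sample consists of $n$ i.i.d. $\tilde\mu$-distributed labelled points, independent of the test point $(x,y)\sim\tilde\mu$), and the Bayes error is $\ell^*(\tilde\mu)=\inf_T\tilde\mu\{(x,y):T(x)\ne y\}$, the infimum over all classifiers. The rule is consistent under $\tilde\mu$ if $\mathrm{err}_{\tilde\mu}(\mathcal L_n)\to\ell^*(\tilde\mu)$ as $n\to\infty$, and universally consistent if it is consistent under every probability measure on $\Omega\times\{0,1\}$. A metric space is given its Borel $\sigma$-algebra; a metric subspace carries the induced metric. The $k$-nearest neighbour ($k$-NN) classifier: fix a sequence $k=k_n$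 with $k_n\to\infty$ and $k_n/n\to0$. Given a sample $\sigma$ of size $n\ge k$ and $x\in\Omega$, let $r(x)$ be the smallest $r\ge0$ such that the closed ball $\bar B_r(x)$ contains at least $k$ of the sample points $x_i$; select $k$ sample points consisting of all $x_i$ with $d(x,x_i)<r(x)$ together with some $x_i$ with $d(x,x_i)=r(x)$, distance ties being broken uniformly at random (e.g. by a uniformly random ordering of the sample, independent of the data). The predicted label is $1$ if the proportion of labels $1$ among the selected $k$ points is $\ge 1/2$, and $0$ otherwise. The density of a metric space is the smallest cardinality of a dense subset. A cardinal $\tau$ is real-valued measurable if there is a probability measure defined on all subsets of $\tau$ that vanishes on singletons and whose ideal of null sets is closed under unions of fewer than $\tau$ members. *)

(* Defs.v *)
From HB Require Import structures.
From mathcomp Require Import all_boot all_order all_algebra all_fingroup.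
From mathcomp Require Import all_classical all_reals all_analysis.
Set Implicit Arguments. Unset Strict Implicit. Unset Printing Implicit Defensive.
Import Order.TTheory GRing.Theory Num.Theory numFieldNormedType.Exports.
Local Open Scope classical_set_scope.
Local Open Scope ring_scope.

Definition ptd (T : Type) (x0 : T) : Type := T.
Section Ptd.
Variables (T : Type) (x0 : T).
Local Notation ptd := (@ptd T x0).
HB.instance Definition _ := gen_eqMixin ptd.
HB.instance Definition _ := gen_choiceMixin ptd.
HB.instance Definition _ := isPointed.Build ptd x0.
End Ptd.

Section Metric.
Variables (R : realType) (T : Type) (d : T -> T -> R).

Definition is_metric : Prop :=
  [/\ forall x y, 0 <= d x y,
      forall x y, d x y = 0 <-> x = y,
      forall x y, d x y = d y x &
      forall x y z, d x z <= d x y + d y z].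

Definition metric_open (U : set T) : Prop :=
  forall x, U x -> exists2 r : R, 0 < r & [set y | d x y < r] `<=` U.

Definition metric_dense (D : set T) : Prop :=
  forall x (r : R), 0 < r -> exists2 y, D y & d x y < r.

Definition metric_separable : Prop := exists D : set T, countable D /\ metric_dense D.
End Metric.


Definition sub_metric (R : realType) (T : Type) (d : T -> T -> R) (S : set T) :
  {x : T | S x} -> {x : T | S x} -> R := fun a b => d (proj1_sig a) (proj1_sig b).
Arguments sub_metric [R T] d S.

(* Omega (with a chosen point, needed by MathComp-Analysis' measurableType
   interface) equipped with its Borel sigma-algebra, times {0,1} = bool,
   with the product sigma-algebra. *)
Notation BorelLab d x0 :=
  (g_sigma_algebraType (@metric_open _ (@ptd _ x0) d) * bool)%type.

Section KNN.
Local Open Scope ereal_scope.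
Variables (R : realType) (T : Type) (d : T -> T -> R) (x0 : T).

(* k-NN prediction at x from the labelled sample s, for a fixed ordering p of
   the sample used to break distance ties (points earlier in p win ties):
   sample point i is selected iff fewer than k sample points precede it in the
   lexicographic order (distance to x, rank in p); predict 1 iff the number of
   label-1 selected points is at least k/2. *)
Definition knn_label (k n : nat) (p : 'S_n) (s : n.-tuple (T * bool)) (x : T) : bool :=
  let key i := d x (tnth s i).1 in
  let prec j i := (key j < key i)%R || ((key j == key i) && (p j < p i)%N) in
  let sel i := (#|[pred j | prec j i]| < k)%N in
  (k <= 2 * #|[pred i | sel i && (tnth s i).2]|)%N.

Variable P : probability (BorelLab d x0) R.

(* n-fold product P^n on n.-tuples, as iterated integrals of sections. *)
Fixpoint iprod (n : nat) : set (n.-tuple (BorelLab d x0)) -> \bar R :=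
  match n with
  | 0 => fun A => (\1_A [tuple])%:E
  | m.+1 => fun A => \int[P]_z @iprod m [set t | A (cons_tuple z t)]
  end.

(* error of the k-NN rule at sample size n: test point (x,y) ~ P, sample ~ P^n,
   tie-breaking ordering uniform over the n! orderings of the sample *)
Definition knn_err (k : nat -> nat) (n : nat) : \bar R :=
  ((n`!)%:R^-1)%:E *
  \sum_(p : 'S_n) \int[P]_z @iprod n [set s | knn_label (k n) p s z.1 != z.2].

Definition bayes_err : \bar R :=
  ereal_inf [set P [set z | h z.1 != z.2] |
             h in [set h : g_sigma_algebraType (@metric_open _ (@ptd _ x0) d) -> bool |
                   measurable_fun setT h]].

Definition knn_consistent (k : nat -> nat) : Prop :=
  knn_err k n @[n --> \oo] --> bayes_err.
End KNN.

Definition knn_univ_consistent (R : realType) (T : Type) (d : T -> T -> R)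
    (k : nat -> nat) : Prop :=
  forall (x0 : T) (P : probability (BorelLab d x0) R), knn_consistent P k.

Local Open Scope card_scope.
Definition card_lt (T U : Type) (A : set T) (B : set U) : Prop :=
  A #<= B /\ ~ (B #<= A).

Definition real_valued_measurable (R : realType) (K : Type) : Prop :=
  exists mu : set K -> R,
    [/\ (forall A, 0 <= mu A)%R, mu setT = 1%R,
        (forall F : nat -> set K, trivIset setT F ->
           (fun n => \sum_(i < n) mu (F i))%R @ \oo --> mu (\bigcup_n F n)),
        (forall x, mu [set x] = 0%R) &
        (forall Fam : set (set K), card_lt Fam [set: K] ->
           (forall A, Fam A -> mu A = 0%R) -> mu (\bigcup_(A in Fam) A) = 0%R)].

(* Main.v *)
(** For the "if" part, a measure on the space is carried by its support, a closed separable
    set, unless a union of null open sets fails to be null; in that case the pieces of a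
    well-ordered cover of this union are uniformly separated, so that the measure induces a
    diffuse measure on all sets of centres.  Restricting it to a minimal set of centres that
    is not small gives a real-valued measurable cardinal, which injects into every dense set.

    For the "only if" part, a real-valued measurable cardinal that is not above the density
    injects, up to a set of full measure, onto a uniformly separated set [e i].  All subsets
    of it being closed, it suffices to find two mutually singular measures on the index set
    such that, seen from almost every [e i], the distances to [e j] have the same law under
    both: labelling one measure by 1 and the other by 0, the Bayes error vanishes while the
    rule, which only sees distances and labels, errs with probability at least 1/4.  If the
    measure has an atom, one takes a two-valued measure and a point mass.  If it is atomless,
    some set is not approximable by sets coded by finite combinations of balls (a weak form of
    the Gitik-Shelah theorem), and the two measures are the positive and negative parts of its
    residue modulo the span of the balls in the space of square integrable functions. *)

Require Import Defs.
From HB Require Import structures.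
From mathcomp Require Import all_boot all_order all_algebra all_fingroup.
From mathcomp Require Import all_classical all_reals all_analysis.
From mathcomp Require Import measurable_realfun lra zify ring.
From mathcomp Require wochoice finmap.
Import Order.TTheory GRing.Theory Num.Theory numFieldNormedType.Exports.
Set Implicit Arguments. Unset Strict Implicit. Unset Printing Implicit Defensive.
Local Open Scope classical_set_scope.
Local Open Scope ring_scope.

(** * Iterated product measures and the label rule *)

(** In a non-separable space the distance need not be measurable for the product sigma-algebra, so
    the error of the rule is an iterated integral of a function that may fail to be measurable. For
    nonnegative functions this is a lower integral, monotone and insensitive to null sets; nothing
    else is used of it until a measurable function has been substituted. Cardinals are replaced by a
    measure: an index set is small when no union of null sets indexed by it is non-null. Smallness
    is stable under products, finite sequences and countable unions, and a map into a small set
    takes, almost everywhere, only countably many values. This turns families of codes into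
    countable unions of rectangles, to which Tonelli's theorem applies. Coefficients and radii are
    rational so that the codes with centres in an initial segment form a small set. The bound 1/4 is
    1/2 times 1/2: the test label is 0 with probability 1/2, and exchanging the labels preserves the
    law of the pairs (distance, label), so the rule then answers 1 with probability at least 1/2. *)

Section LowerIntegral.
Local Open Scope ereal_scope.
Context d (T : measurableType d) (R : realType).
Variable mu : {measure set T -> \bar R}.
Import HBNNSimple.

(* The integral of a nonnegative function, measurable or not, is the supremum of the
   integrals of the simple functions below it. *)
Lemma ge0_le_integral_nomeas (f g : T -> \bar R) :
  (forall x, 0 <= f x) -> (forall x, f x <= g x) ->
  \int[mu]_x f x <= \int[mu]_x g x.
Proof.
move=> f0 fg; have g0 x : 0 <= g x by exact: le_trans (f0 x) (fg x).
rewrite !ge0_integralTE//; apply: le_ereal_sup => _ [h /= hf <-].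
by exists h => //= x; exact: le_trans (hf x) (fg x).
Qed.

(** A simple function below [f] can be cut down to [E] without changing its integral, and then lies
    below [g]; this argument involves no measurability of [f] or [g]. *)
Lemma ge0_integral_eq_full (E : set T) (f g : T -> \bar R) :
  measurable E -> mu (~` E) = 0 ->
  (forall x, 0 <= f x) -> (forall x, 0 <= g x) ->
  (forall x, E x -> f x = g x) ->
  \int[mu]_x f x = \int[mu]_x g x.
Proof.
move=> mE E0.
have key (f' g' : T -> \bar R) : (forall x, 0 <= f' x) -> (forall x, 0 <= g' x) ->
    (forall x, E x -> f' x = g' x) -> \int[mu]_x f' x <= \int[mu]_x g' x.
  move=> f0 g0 fg; rewrite !ge0_integralTE//; apply: ge_ereal_sup => _ [h /= hf <-].
  rewrite -integralT_nnsfun.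
  rewrite (_ : \int[mu]_x (h x)%:E = \int[mu]_(x in E) (h x)%:E); last first.
    rewrite -(setUv E) ge0_integral_setU//=; last 4 first.
    - exact: measurableC.
    - by rewrite setUv; exact/measurable_EFinP.
    - by move=> x _; rewrite lee_fin.
    - by apply/disj_setPS => x [].
    rewrite [X in _ + X](_ : _ = 0) ?adde0//.
    apply: (null_set_integral) => //.
      exact: measurableC.
    apply/measurable_EFinP. exact: measurable_funTS.
  rewrite integral_mkcond.
  rewrite (_ : (fun x => (h x)%:E) \_ E = fun x => ((h \_ E) x)%:E); last first.
    by apply/funext => x; rewrite /patch; case: ifP.
  rewrite -ge0_integralTE//.
  apply: ge0_le_integral_nomeas => x; rewrite /patch; case: ifPn => //.
    by rewrite lee_fin.
  by rewrite inE => Ex; rewrite -fg.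
by move=> f0 g0 fg; apply/eqP; rewrite eq_le !key// => x Ex; rewrite fg.
Qed.

End LowerIntegral.

Section GProd.
Local Open Scope ereal_scope.

(** The recursion of [iprod] over an arbitrary measurable space, so that it can be pushed forward to
    pairs (distance, label). *)
Fixpoint gprod (R : realType) d (X : measurableType d) (P : set X -> \bar R) (n : nat) :
    set (n.-tuple X) -> \bar R :=
  match n with
  | 0 => fun A => (\1_A [tuple])%:E
  | m.+1 => fun A => \int[P]_z @gprod R d X P m [set t | A (cons_tuple z t)]
  end.

Lemma gprod_ge0 (R : realType) d (X : measurableType d) (P : {measure set X -> \bar R}) n A :
  0 <= @gprod R d X P n A.
Proof.
by elim: n A => [|n IH] A /=; [rewrite lee_fin|exact: integral_ge0].
Qed.

(** The parameter space [Z] makes the induction work: the first coordinate of the tuple is moved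
    into it, and the outer integration preserves measurability by Tonelli's theorem. *)
Lemma measurable_gprod_xsection (R : realType) d (X : measurableType d) (P : probability X R) n
   dz (Z : measurableType dz) (A : set (Z * n.-tuple X)) :
  measurable A -> measurable_fun setT (fun z => gprod P (xsection A z)).
Proof.
elim: n dz Z A => [|n IH] dz Z A mA.
  rewrite /=; apply/measurable_EFinP.
  rewrite (_ : (fun z => _) = \1_(ysection A [tuple])); last first.
    by apply/funext => z; rewrite /indic mem_ysection mem_xsection.
  exact/measurable_indicP/measurable_ysection.
pose f (w : (Z * X) * n.-tuple X) : Z * n.+1.-tuple X :=
  (w.1.1, [the n.+1.-tuple X of w.1.2 :: w.2]).
have mf : measurable_fun setT f.
  apply: measurable_fun_pair; first exact: measurableT_comp.
  apply: measurable_cons => //; exact: measurableT_comp.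
have mA' : measurable (f @^-1` A) by rewrite -[X in measurable X]setTI; exact: mf.
have := IH _ _ _ mA' => mg.
have := @measurable_fun_fubini_tonelli_F _ _ Z X R P _ mg.
move=> /(_ (fun=> gprod_ge0 _ _)).
apply: eq_measurable_fun => z _; rewrite /fubini_F/=.
apply: eq_integral => x _; congr (gprod _ _); apply/funext => t.
Qed.

Lemma measurable_cons_section (R : realType) d (X : measurableType d) n
    (A : set (n.+1.-tuple X)) (z : X) :
  measurable A -> measurable [set t : n.-tuple X | A (cons_tuple z t)].
Proof.
move=> mA; rewrite (_ : mkset _ = (fun t : n.-tuple X => [the n.+1.-tuple X of z :: t]) @^-1` A).
  by rewrite -[X in measurable X]setTI; apply: measurable_cons.
by apply/seteqP; split => t /=; congr (A _); exact/val_inj.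
Qed.

Lemma measurable_gprod_cons (R : realType) d (X : measurableType d) (P : probability X R) n
    (A : set (n.+1.-tuple X)) :
  measurable A -> measurable_fun setT (fun z => gprod P [set t | A (cons_tuple z t)]).
Proof.
move=> mA.
pose f (w : X * n.-tuple X) := [the n.+1.-tuple X of w.1 :: w.2].
have mf : measurable_fun setT f by apply: measurable_cons.
have mA' : measurable (f @^-1` A) by rewrite -[X in measurable X]setTI; exact: mf.
have := measurable_gprod_xsection P mA'; apply: eq_measurable_fun => z _.
congr (gprod _ _); apply/seteqP; split => t; rewrite /xsection/= inE/= /f/=;
  congr (A _); exact/val_inj.
Qed.

Lemma gprod_le (R : realType) d (X : measurableType d) (P : probability X R) n
    (A B : set (n.-tuple X)) : A `<=` B -> gprod P A <= gprod P B.
Proof.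
elim: n A B => [|n IH] A B AB /=; first (rewrite lee_fin !indicE ler_nat;
    by case: (boolP (_ \in A)) => // /set_mem/AB/mem_set ->).
apply: ge0_le_integral_nomeas => [z|z]; first exact: gprod_ge0.
by apply: IH => t; exact: AB.
Qed.

Lemma gprod_setC (R : realType) d (X : measurableType d) (P : probability X R) n
    (A : set (n.-tuple X)) : measurable A ->
  gprod P A + gprod P (~` A) = 1.
Proof.
elim: n A => [|n IH] A mA /=.
  rewrite !indicE -EFinD; congr EFin; rewrite in_setC.
  by case: (_ \in A); rewrite /= ?addr0 ?add0r.
rewrite -ge0_integralD//=; last 4 first.
- by move=> z _; exact: gprod_ge0.
- exact: measurable_gprod_cons.
- by move=> z _; exact: gprod_ge0.
- exact: (measurable_gprod_cons P (measurableC mA)).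
rewrite (eq_integral (cst 1)) => [|z _].
  by rewrite integral_cst//= mul1e; exact: probability_setT.
by rewrite -(IH [set t | A (cons_tuple z t)])//; exact: measurable_cons_section.
Qed.

Lemma gprod_pushforward (R : realType) d d' (X : measurableType d) (Y : measurableType d')
    (P : probability X R) (Q : probability Y R) (phi : X -> Y) n (A : set (n.-tuple Y)) :
  measurable_fun setT phi ->
  (forall B, measurable B -> Q B = P (phi @^-1` B)) ->
  measurable A ->
  gprod Q A = gprod P [set t | A (map_tuple phi t)].
Proof.
move=> mphi QP; elim: n A => [|n IH] A mA /=.
  by rewrite /indic/=; congr (_%:R%:E); congr nat_of_bool; apply/idP/idP; rewrite !inE/=;
    congr (A _); exact/val_inj.
have mF := measurable_gprod_cons Q mA.
rewrite (eq_measure_integral (pushforward P phi)); last by move=> B mB _; exact: QP.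
rewrite ge0_integral_pushforward//; last by move=> z _; exact: gprod_ge0.
rewrite preimage_setT; apply: eq_integral => z _ /=.
rewrite IH; last exact: measurable_cons_section.
congr (gprod _ _); apply/seteqP; split => t /=; congr (A _); exact/val_inj.
Qed.

Lemma iprodE (R : realType) (T : Type) (d : T -> T -> R) (x0 : T)
    (P : probability (BorelLab d x0) R) n (A : set (n.-tuple (BorelLab d x0))) :
  iprod P A = gprod P A.
Proof.
elim: n A => [//|n IH] A /=; by apply: eq_integral => z _; exact: IH.
Qed.

End GProd.

Section BoolComb.

(** The prediction depends on the sample only through finitely many comparisons and labels, so its
    preimages are finite unions over truth assignments. *)
Lemma measurable_bool_comb d (W : measurableType d) (I : finType) (b : I -> W -> bool)
    (G : {ffun I -> bool} -> bool) :
  (forall i, measurable_fun setT (b i)) ->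
  measurable_fun setT (fun w => G [ffun i => b i w]).
Proof.
move=> mb _ Y mY; rewrite setTI.
rewrite (_ : _ @^-1` _ = \bigcup_(f in [set f | Y (G f)]) \bigcap_(i in [set: I]) (b i @^-1` [set f i])).
  apply: fin_bigcup_measurable => [|f _]; first exact: finite_finset.
  apply: fin_bigcap_measurable => [|i _]; first exact: finite_finset.
  by rewrite -[X in measurable X]setTI; exact: mb.
apply/seteqP; split => [w /= Yw|w [f /= Yf wf]].
  by exists [ffun i => b i w] => // i _ /=; rewrite ffunE.
by rewrite (_ : [ffun i => b i w] = f)//; apply/ffunP => i; rewrite ffunE; exact: wf.
Qed.

End BoolComb.

Section Labels.
Variable R : realType.

Definition label_of_keys (k n : nat) (p : 'S_n) (key : 'I_n -> R) (y : 'I_n -> bool) : bool :=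
  let prec j i := (key j < key i)%R || ((key j == key i) && (p j < p i)%N) in
  let sel i := (#|[pred j | prec j i]| < k)%N in
  (k <= 2 * #|[pred i | sel i && y i]|)%N.

Lemma knn_labelE (T : Type) (d : T -> T -> R) k n (p : 'S_n) (s : n.-tuple (T * bool)) x :
  knn_label d k p s x =
  label_of_keys k p (fun i => d x (tnth s i).1) (fun i => (tnth s i).2).
Proof. by []. Qed.

Lemma measurable_label_of_keys d (W : measurableType d) k n (p : 'S_n)
    (key : 'I_n -> W -> R) (y : 'I_n -> W -> bool) :
  (forall i, measurable_fun setT (key i)) -> (forall i, measurable_fun setT (y i)) ->
  measurable_fun setT (fun w => label_of_keys k p (key ^~ w) (y ^~ w)).
Proof.
move=> mkey my.
pose I := ('I_n * 'I_n + 'I_n * 'I_n + 'I_n)%type.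
pose b (i : I) (w : W) : bool := match i with
  | inl (inl ji) => key ji.1 w < key ji.2 w
  | inl (inr ji) => key ji.1 w == key ji.2 w
  | inr i => y i w end.
pose G (f : {ffun I -> bool}) : bool :=
  let prec j i := f (inl (inl (j, i))) || (f (inl (inr (j, i))) && (p j < p i)%N) in
  let sel i := (#|[pred j | prec j i]| < k)%N in
  (k <= 2 * #|[pred i | sel i && f (inr i)]|)%N.
have := @measurable_bool_comb _ W I b G.
have mb i : measurable_fun setT (b i).
  case: i => [[[j i]|[j i]]|i] //=.
  - exact: measurable_fun_ltr.
  - exact: measurable_fun_eqr.
  - exact: my.
move=> /(_ mb); apply: eq_measurable_fun => w _.
rewrite /G /label_of_keys; congr (_ <= 2 * _)%N; apply: eq_card => i; rewrite !inE.
congr (_ && _); last by rewrite ffunE.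
by congr (_ < _)%N; apply: eq_card => j; rewrite !inE !ffunE.
Qed.

(** The rank is an injection of ['I_n] into itself, hence a bijection, so [k] elements have rank
    below [k]: the rule does find enough sample points to select. *)
Lemma card_rank_lt (n k : nat) (prec : rel 'I_n) :
  irreflexive prec -> transitive prec -> (forall i j, i != j -> prec i j || prec j i) ->
  (k <= n)%N -> (k <= #|[pred i | (#|[pred j | prec j i]| < k)%N]|)%N.
Proof.
move=> irr tr tot kn.
have rkP i : (#|[pred j | prec j i]| < n)%N.
  rewrite -[ltnRHS](card_ord n); apply: proper_card; apply/properP; split.
    by apply/fintype.subsetP.
  by exists i; rewrite // inE irr.
pose rk i : 'I_n := Ordinal (rkP i).
have lt_rk i j : prec i j -> (rk i < rk j)%N.
  move=> ij; apply: proper_card; apply/properP; split.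
    by apply/fintype.subsetP => l; rewrite !inE => /tr; exact.
  by exists i; rewrite !inE ?irr.
have rk_inj : injective rk.
  move=> i j ij; apply/eqP; apply/negPn/negP => /tot /orP[] /lt_rk; rewrite ij ltnn//.
have [g gK Kg] := injF_bij rk_inj.
rewrite -[leqLHS](card_ord k).
have winj : injective (fun m : 'I_k => g (widen_ord kn m)).
  by move=> m m' /(can_inj Kg) /(congr1 val) /= /val_inj.
rewrite -(card_codom winj); apply: subset_leq_card; apply/fintype.subsetP => i /codomP[m ->].
by rewrite inE -[X in (X < _)%N]/(nat_of_ord (rk (g (widen_ord kn m)))) Kg /=.
Qed.

(* Flipping all the labels turns a minority of ones among the k selected points into
   a majority, so the two predictions cannot both be 0. *)
Lemma label_of_keys_flip k n (p : 'S_n) (key : 'I_n -> R) (y : 'I_n -> bool) :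
  (k <= n)%N -> label_of_keys k p key y || label_of_keys k p key (fun i => ~~ y i).
Proof.
move=> kn.
pose prec (j i : 'I_n) := (key j < key i)%R || ((key j == key i) && (p j < p i)%N).
pose sel (i : 'I_n) := (#|[pred j | prec j i]| < k)%N.
change (is_true ((k <= 2 * #|[pred i | sel i && y i]|)%N ||
  (k <= 2 * #|[pred i | sel i && ~~ y i]|)%N)).
have ksel : (k <= #|[pred i | sel i]|)%N.
  apply: card_rank_lt => //.
  - by move=> i; rewrite /prec ltxx ltnn andbF.
  - move=> j i l; rewrite /prec => /orP[ij|/andP[/eqP ij pij]] /orP[jl|/andP[/eqP jl pjl]].
    + by rewrite (lt_trans ij jl).
    + by rewrite -jl ij.
    + by rewrite ij jl.
    + by rewrite ij jl eqxx (ltn_trans pij pjl) orbT.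
  - move=> i j ij; rewrite /prec; case: ltgtP => //= _.
    have : (p i != p j) by rewrite (inj_eq perm_inj).
    by rewrite -val_eqE /= neq_ltn.
apply: contraT; rewrite negb_or -!ltnNge => /andP[h1 h2].
have : (#|[pred i | sel i]| = #|[pred i | sel i && y i]| + #|[pred i | sel i && ~~ y i]|)%N.
  rewrite -(cardID [pred i | y i] [pred i | sel i]); congr (_ + _)%N;
  by apply: eq_card => i; rewrite !inE// andbC.
by move=> e; move: ksel; rewrite e; lia.
Qed.

End Labels.

(** * Separable subspaces *)

Lemma measurable_fun_lt_rays d (W : measurableType d) (R : realType) (f : W -> R) :
  (forall r, measurable [set w | f w < r]) -> measurable_fun setT f.
Proof.
move=> mf; apply: (measurability _ (RGenInftyO.measurableE R)).
move=> _ [_ [r ->] <-]; rewrite setTI.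
rewrite (_ : _ @^-1` _ = [set w | f w < r])//.
Qed.

Section MetricBorel.
Variables (R : realType) (T : Type) (d : T -> T -> R) (x0 : T).
Hypothesis dm : is_metric d.
Local Notation B := (g_sigma_algebraType (@metric_open R (ptd x0) d)).

Lemma metric_ge0 x y : 0 <= d x y. Proof. by case: dm. Qed.
Lemma metric_refl x : d x x = 0. Proof. by case: dm => _ h _ _; exact/h. Qed.
Lemma metric_sym x y : d x y = d y x. Proof. by case: dm. Qed.
Lemma metric_tri x y z : d x z <= d x y + d y z. Proof. by case: dm. Qed.
Lemma metric_eq0 x y : d x y = 0 -> x = y. Proof. by case: dm => _ h _ _ /h. Qed.

Lemma metric_open_measurable (U : set B) : metric_open d U -> measurable U.
Proof. by move=> oU; exact: sub_sigma_algebra. Qed.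

Lemma metric_open_ball a r : metric_open d [set y | d a y < r].
Proof.
move=> x /= ax; exists (r - d a x); first by rewrite subr_gt0.
by move=> y /= xy; have := metric_tri a x y; lra.
Qed.

Lemma measurable_metric a : measurable_fun setT (d a : B -> R).
Proof.
by apply: measurable_fun_lt_rays => r; apply: metric_open_measurable;
  exact: metric_open_ball.
Qed.

End MetricBorel.

Lemma countable_range (X : Type) (D : set X) (x0 : X) : countable D ->
  exists a : nat -> X, forall x, D x -> exists n, a n = x.
Proof.
move=> /countable_injP [f fi].
exists (fun n => if pselect (exists x, D x /\ f x = n) is left h then projT1 (cid h) else x0).
move=> x Dx; exists (f x); case: pselect => [h|[]]; last by exists x.
by case: cid => y /= [Dy fyx]; apply: fi; rewrite ?inE.
Qed.

Section Transfer.
Variables (R : realType) (T : Type) (d : T -> T -> R) (S : set T).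
Hypothesis dm : is_metric d.
Hypothesis sepS : metric_separable (sub_metric d S).
Variables (x0 : T) (s0 : {x | S x}).
Local Notation B := (g_sigma_algebraType (@metric_open R (ptd x0) d)).
Local Notation BS := (g_sigma_algebraType (@metric_open R (ptd s0) (sub_metric d S))).
Local Notation phi := (fun z : BS * bool => (proj1_sig z.1, z.2) : B * bool).
Variables (P : probability (BorelLab d x0) R) (P' : probability (BorelLab (sub_metric d S) s0) R).
Hypothesis PP' : forall A : set (BorelLab d x0), measurable A -> P A = P' (phi @^-1` A).

Lemma measurable_sval : measurable_fun setT (fun x : BS => proj1_sig x : B).
Proof.
refine (@measurability _ _ BS B _ _ (@metric_open R (ptd x0) d) erefl _) => _ [U oU <-].
rewrite setTI; apply: metric_open_measurable => x /= Ux.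
have [r r0 rU] := oU _ Ux; exists r => // y /= xy; exact: rU.
Qed.

Let measurable_phi : measurable_fun setT phi.
Proof.
apply: measurable_fun_pair => //; exact: (measurableT_comp measurable_sval measurable_fst).
Qed.

Lemma borel_subspace_trace (E' : set BS) : measurable E' ->
  exists2 E : set B, measurable E & E' = (fun x : BS => proj1_sig x : B) @^-1` E.
Proof.
have sub : <<s @metric_open R (ptd s0) (sub_metric d S) >> `<=`
    <<s setT, preimage_set_system setT (fun x : BS => proj1_sig x : B) (@metric_open R (ptd x0) d) >>.
  apply: sub_sigma_algebra2 => U oU.
  (* The ambient open set is the union of all balls centred in [S] whose trace on [S] lies in
     [U]. *)
  exists (fun y => exists x r, [/\ 0 < r, d (proj1_sig x) y < r &
      [set z | sub_metric d S x z < r] `<=` U]).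
    move=> y [x [r [r0 xy xU]]].
    exists (r - d (proj1_sig x) y); first by rewrite subr_gt0.
    move=> z /= yz; exists x, r; split => //.
    by have := metric_tri dm (proj1_sig x) y z; lra.
  rewrite setTI; apply/seteqP; split => y /=.
    by move=> [x [r [r0 xy]]]; exact.
  move=> Uy; have [r r0 rU] := oU _ Uy; exists y, r; split => //.
  by rewrite metric_refl.
move=> /sub; rewrite g_sigma_preimageE => -[E mE <-]; exists E => //.
by rewrite setTI.
Qed.

(** Every Borel set of [S] is the trace of one of [T], so the classifiers on [S] are the
    restrictions of those on [T] and both infima run over the same errors. *)
Lemma bayes_err_subspace : bayes_err P = bayes_err P'.
Proof.
have merr (h : B -> bool) : measurable_fun setT h ->
    P [set z | h z.1 != z.2] = P' [set z | h (proj1_sig z.1) != z.2].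
  move=> mh; rewrite PP'//.
  have -> : [set z : B * bool | h z.1 != z.2] = (fun z : B * bool => ~~ (h z.1 == z.2)) @^-1` [set true].
    by apply/seteqP; split => z /=.
  rewrite -[X in measurable X]setTI.
  have mb : measurable_fun setT (fun z : B * bool => ~~ (h z.1 == z.2)).
    apply: measurable_neg.
    have -> : (fun z : B * bool => h z.1 == z.2) =
        (fun z => (h z.1 && z.2) || (~~ h z.1 && ~~ z.2)).
      by apply/funext => z; case: (h _); case: (z.2).
    have m1 : measurable_fun setT (fun z : B * bool => h z.1) by exact: measurableT_comp.
    have m2 : measurable_fun setT (fun z : B * bool => z.2) by exact: measurable_snd.
    by apply: measurable_or; apply: measurable_and => //; apply: measurable_neg.
  exact: mb.
rewrite /bayes_err; congr ereal_inf; apply/seteqP; split => [_ [h /= mh <-]|_ [h' /= mh' <-]].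
  exists (fun x : BS => h (proj1_sig x)); first exact: (measurableT_comp mh measurable_sval).
  by rewrite merr.
have mE' : measurable (h' @^-1` [set true]) by rewrite -[X in measurable X]setTI; exact: mh'.
have [E mE hE] := borel_subspace_trace mE'.
have mh : measurable_fun setT (fun x : B => `[< E x >]).
  apply: (measurable_fun_bool true); rewrite setTI.
  rewrite (_ : _ @^-1` _ = E)//; apply/seteqP; split => x /=; [by move/asboolP|by move=> ?; apply/asboolP].
have hEE x : `[< E (proj1_sig x) >] = h' x.
  have [h1 h2] : (h' @^-1` [set true]) x <-> E (proj1_sig x) by rewrite hE.
  by apply/idP/idP => [/asboolP/h2|h] //; apply/asboolP/h1.
exists (fun x : B => `[< E x >]) => //.
transitivity (P' [set z | `[< E (proj1_sig z.1) >] != z.2]); first exact: (merr _ mh).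
by congr (P' _); apply/seteqP; split => z /=; rewrite hEE.
Qed.


(* [inf_metric a] agrees with [d] as soon as the first argument is adherent to the sequence [a],
   but, unlike [d], it is jointly measurable for the product sigma-algebra even when
   the whole space is not separable. *)
Definition inf_metric (a : nat -> T) (x y : T) : R := inf (range (fun n => d x (a n) + d (a n) y)).

Let adherent (a : nat -> T) : set T := [set x | forall r : R, 0 < r -> exists n, d x (a n) < r].

Lemma inf_metricE a x y : adherent a x -> inf_metric a x y = d x y.
Proof.
move=> ax; apply/eqP; rewrite eq_le; apply/andP; split; last first.
  apply: lb_le_inf; first by exists (d x (a 0%N) + d (a 0%N) y), 0%N.
  by move=> _ [n _ <-]; exact: metric_tri.
apply/ler_addgt0Pr => e e0; have [n xn] := ax (e / 2) (divr_gt0 e0 (ltr0Sn _ 1)).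
apply: (@le_trans _ _ (d x (a n) + d (a n) y)).
  apply: ge_inf; last by exists n.
  exists 0 => _ [m _ <-]; apply: addr_ge0; exact: metric_ge0.
by have := metric_tri dm (a n) x y; rewrite (metric_sym dm (a n) x); lra.
Qed.

Lemma measurable_adherent (a : nat -> T) : measurable (adherent a : set B).
Proof.
rewrite (_ : adherent a = \bigcap_m \bigcup_n [set x | d (a n) x < m.+1%:R^-1]).
  apply: bigcapT_measurable => m; apply: bigcupT_measurable => n.
  apply: metric_open_measurable; exact: metric_open_ball.
apply/seteqP; split => [x ax m _|x ax r r0].
  by have [n xn] := ax m.+1%:R^-1 (ltac:(by [])); exists n => //=; rewrite metric_sym.
have [m mr] : exists m, m.+1%:R^-1 < r.
  have [m rm] := ltr_add_invr r0; exists m; by rewrite add0r in rm.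
have [n _ /= xn] := ax m I; exists n; rewrite metric_sym//; exact: lt_trans mr.
Qed.

Lemma measurable_inf_metric dw (W : measurableType dw) (a : nat -> T) (f g : W -> B) :
  measurable_fun setT f -> measurable_fun setT g ->
  measurable_fun setT (fun w => inf_metric a (f w) (g w)).
Proof.
move=> mf mg; apply: measurable_fun_lt_rays => r.
rewrite (_ : mkset _ = \bigcup_n [set w | d (a n) (f w) + d (a n) (g w) < r]).
  apply: bigcupT_measurable => n.
  have mfg : measurable_fun setT (fun w => d (a n) (f w) + d (a n) (g w)).
    apply: measurable_funD.
    - exact: (measurableT_comp (@measurable_metric R T d x0 dm (a n)) mf).
    - exact: (measurableT_comp (@measurable_metric R T d x0 dm (a n)) mg).
  rewrite -[X in measurable X]setTI.
  rewrite (_ : mkset _ = (fun w => d (a n) (f w) + d (a n) (g w)) @^-1` `]-oo, r[%classic).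
    exact: mfg.
  by apply/seteqP; split => w /=; rewrite in_itv.
apply/seteqP; split => [w /= wr|w [n _ /= wr]].
  have [|_ [n _ <-] nr] := inf_lt _ wr.
    by exists (d (f w) (a 0%N) + d (a 0%N) (g w)), 0%N.
  by exists n => //=; rewrite (metric_sym dm (a n) (f w)).
apply: le_lt_trans wr; apply: ge_inf.
  by exists 0 => _ [m _ <-]; apply: addr_ge0; exact: metric_ge0.
by exists n => //; rewrite (metric_sym dm (a n) (f w)).
Qed.

Lemma separable_adherent : exists a : nat -> T, forall x, S x -> adherent a x.
Proof.
have [D [cD dD]] := sepS; have [a aD] := countable_range s0 cD.
exists (fun n => proj1_sig (a n)) => x Sx r r0.
have [y Dy xy] := dD (exist _ x Sx) r r0.
by have [n an] := aD _ Dy; exists n; rewrite an.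
Qed.

(** The test point is almost surely adherent to [a], and only the first argument of [inf_metric] has
    to be. So for each ordering [p] the error is the product measure of a measurable set of
    (n+1)-tuples, with the test point as entry [ord0], and such a measure can be transported along
    [phi]. *)
Lemma knn_err_subspace k n : knn_err P k n = knn_err P' k n.
Proof.
rewrite /knn_err; congr (_ * _)%E; apply: eq_bigr => p _.
have [a aS] := separable_adherent.
pose A : set (n.+1.-tuple (B * bool)) := [set w |
  label_of_keys (k n) p (fun i => inf_metric a (tnth w ord0).1 (tnth w (lift ord0 i)).1)
    (fun i => (tnth w (lift ord0 i)).2) != (tnth w ord0).2].
have mA : measurable A.
  pose g (w : n.+1.-tuple (B * bool)) : bool :=
    label_of_keys (k n) p (fun i => inf_metric a (tnth w ord0).1 (tnth w (lift ord0 i)).1)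
    (fun i => (tnth w (lift ord0 i)).2) (+) (tnth w ord0).2.
  have mg : measurable_fun setT g.
    have mlab : measurable_fun setT (fun w : n.+1.-tuple (B * bool) =>
      label_of_keys (k n) p (fun i => inf_metric a (tnth w ord0).1 (tnth w (lift ord0 i)).1)
      (fun i => (tnth w (lift ord0 i)).2)).
      have mt1 i : measurable_fun setT (fun w : n.+1.-tuple (B * bool) => (tnth w i).1).
        by apply: measurableT_comp => //; exact: measurable_tnth.
      have mt2 i : measurable_fun setT (fun w : n.+1.-tuple (B * bool) => (tnth w i).2).
        by apply: measurableT_comp => //; exact: measurable_tnth.
      have := @measurable_label_of_keys R _ (n.+1.-tuple (B * bool))%type (k n) n p
        (fun i w => inf_metric a (tnth w ord0).1 (tnth w (lift ord0 i)).1)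
        (fun i w => (tnth w (lift ord0 i)).2).
      by apply => i //; exact: measurable_inf_metric.
    have mb : measurable_fun setT (fun w : n.+1.-tuple (B * bool) => (tnth w ord0).2).
      by apply: measurableT_comp => //; exact: measurable_tnth.
    rewrite /g (_ : (fun w => _) = (fun w : n.+1.-tuple (B * bool) => 
      (label_of_keys (k n) p (fun i => inf_metric a (tnth w ord0).1 (tnth w (lift ord0 i)).1)
      (fun i => (tnth w (lift ord0 i)).2) && ~~ (tnth w ord0).2) ||
      (~~ label_of_keys (k n) p (fun i => inf_metric a (tnth w ord0).1 (tnth w (lift ord0 i)).1)
      (fun i => (tnth w (lift ord0 i)).2) && (tnth w ord0).2))); last first.
      by apply/funext => w; case: label_of_keys; case: (_.2).
    by apply: measurable_or; apply: measurable_and => //; exact: measurable_neg.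
  rewrite (_ : A = g @^-1` [set true]); first by rewrite -[X in measurable X]setTI; exact: mg.
  by apply/seteqP; split => w; rewrite /A /g /=; case: label_of_keys; case: (_.2).
transitivity (gprod P A).
  apply: (@ge0_integral_eq_full _ (B * bool)%type R P (adherent a `*` setT) _
    (fun z => gprod P [set s | A (cons_tuple z s)])).
  - by apply: measurableX => //; exact: measurable_adherent.
  - transitivity (P' (phi @^-1` (~` (adherent a `*` setT)))).
      by apply: PP'; apply: measurableC; apply: measurableX => //; exact: measurable_adherent.
    rewrite (_ : _ @^-1` _ = set0) ?measure0//; apply/seteqP; split => // -[x b] /=.
    by case; split => //; apply: aS; exact: (proj2_sig x).
  - by move=> z; rewrite iprodE gprod_ge0.
  - by move=> z; exact: gprod_ge0.
  - move=> z [az _]; rewrite iprodE; congr (gprod _ _); apply/funext => s.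
    rewrite /mkset /A /= knn_labelE tnth0; congr (is_true (_ != _)).
    by congr label_of_keys; apply/funext => i; rewrite tnthS ?inf_metricE.
rewrite (gprod_pushforward measurable_phi PP' mA) /=.
apply: eq_integral => z _; rewrite iprodE; congr (gprod _ _).
apply/funext => s; rewrite /mkset /A /= knn_labelE; congr (is_true (_ != _)).
congr label_of_keys; apply/funext => i; rewrite tnth_map tnthS//.
by rewrite inf_metricE//; apply: aS; exact: (proj2_sig z.1).
Qed.

Lemma knn_consistent_subspace k : knn_consistent P k <-> knn_consistent P' k.
Proof.
rewrite /knn_consistent bayes_err_subspace.
by rewrite (_ : knn_err P k = knn_err P' k)//; apply/funext => n; exact: knn_err_subspace.
Qed.

End Transfer.

Set Strict Implicit.

(** * Diffuse measures on all subsets and small sets of indices *)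

Section MkProb.
Context d (T : measurableType d) (R : realType).

Section Instance.
Variable f : set T -> \bar R.
Hypotheses (f0 : f set0 = 0%E) (f_ge0 : forall A, (0 <= f A)%E)
  (f_sigma : semi_sigma_additive f) (f1 : f setT = 1%E).

Definition mkprob of f set0 = 0%E & (forall A, (0 <= f A)%E) & semi_sigma_additive f
  & f setT = 1%E : set T -> \bar R := f.

HB.instance Definition _ := isMeasure.Build _ _ _ (mkprob f0 f_ge0 f_sigma f1) f0 f_ge0 f_sigma.
HB.instance Definition _ :=
  Measure_isProbability.Build _ _ _ (mkprob f0 f_ge0 f_sigma f1) f1.

Lemma mkprob_ex : exists P : probability T R, forall A, P A = f A.
Proof. by exists (mkprob f0 f_ge0 f_sigma f1). Qed.
End Instance.

Local Open Scope ereal_scope.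

(** Measurability is asked of [phi] on [U] alone, because the map [al] to least centres in
    [null_part_null] is controlled only on one piece. *)
Lemma measure_condition_pushforward dX (X : measurableType dX) (m : {measure set X -> \bar R})
    (U : set X) (phi : X -> T) :
  measurable U -> m U != 0 -> m U < +oo -> measurable_fun U phi ->
  exists P : probability T R, forall A, P A = m (phi @^-1` A `&` U) * (fine (m U))^-1%:E.
Proof.
move=> mU U0 Uoo mphi.
have finU : m U \is a fin_num by rewrite ge0_fin_numE.
have pre A : measurable A -> measurable (phi @^-1` A `&` U).
  by move=> mA; rewrite setIC; exact: mphi.
apply: (@mkprob_ex (fun A => m (phi @^-1` A `&` U) * (fine (m U))^-1%:E)).
- by rewrite preimage_set0 set0I measure0 mul0e.
- move=> A; rewrite mule_ge0// lee_fin invr_ge0 fine_ge0//.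
- move=> F mF tF mUF.
  rewrite [X in X @ _ --> _](_ : _ = (fun n => \sum_(0 <= i < n) m (phi @^-1` F i `&` U)) \*
      cst (fine (m U))^-1%:E); last first.
    apply/funext => n; rewrite -ge0_sume_distrl// => i _.
  apply: cvgeZr => //; rewrite preimage_bigcup setI_bigcupl.
  apply: measure_semi_sigma_additive.
  + by move=> i; exact: pre.
  + apply/trivIsetP => i j _ _ ij; rewrite setIACA -preimage_setI.
    by move/trivIsetP : tF => ->//; rewrite preimage_set0 set0I.
  + by rewrite -setI_bigcupl -preimage_bigcup; exact: pre.
- by rewrite preimage_setT setTI -{1}(fineK finU) -EFinM divff// fine_eq0.
Qed.

Lemma probability_pushforward dX (X : measurableType dX) (m : probability X R) (phi : X -> T) :
  measurable_fun setT phi ->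
  exists P : probability T R, forall A, P A = m (phi @^-1` A).
Proof.
move=> mphi.
have mT1 : m setT = 1 by exact: probability_setT.
have h1 : m setT != 0 by rewrite mT1 onee_neq0.
have h2 : m setT < +oo by rewrite mT1 ltry.
have [P PE] := @measure_condition_pushforward _ X m setT phi measurableT h1 h2 mphi.
exists P => A; transitivity (m (phi @^-1` A `&` setT) * (fine (m setT))^-1%:E); first exact: PE.
by rewrite mT1 invr1 mule1 setIT.
Qed.

End MkProb.

Definition discr (T : Type) (x0 : T) : Type := T.
Section Discr.
Variables (T : Type) (x0 : T).
Local Notation discr := (@discr T x0).
HB.instance Definition _ := gen_eqMixin discr.
HB.instance Definition _ := gen_choiceMixin discr.
HB.instance Definition _ := isPointed.Build discr x0.
HB.instance Definition _ := @isMeasurable.Build default_measure_display discr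
  discrete_measurable discrete_measurable0 discrete_measurableC discrete_measurableU.
End Discr.

Section DiscrMeasure.
Local Open Scope ereal_scope.
Variables (R : realType) (T : Type) (x0 : T).
Variable nu : probability (discr x0) R.
Implicit Types A B : set T.

Lemma discr_measurable A : measurable (A : set (discr x0)). Proof. by []. Qed.

Lemma discr_measurable_fun d (Y : measurableType d) (D : set T) (f : T -> Y) :
  measurable_fun (D : set (discr x0)) (f : discr x0 -> Y).
Proof. by []. Qed.

Lemma null_sub A B : A `<=` B -> nu B = 0 -> nu A = 0.
Proof.
move=> AB B0; apply/eqP; rewrite -measure_le0 -B0; apply: le_measure => //;
  by rewrite inE.
Qed.

Lemma null_bigcup (F : nat -> set T) : (forall n, nu (F n) = 0) -> nu (\bigcup_n F n) = 0.
Proof.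
move=> F0; apply/eqP; rewrite -measure_le0.
have := @measure_sigma_subadditive _ _ _ nu (\bigcup_n F n) F.
move=> /(_ (fun=> discr_measurable _) (discr_measurable _) (@subset_refl _ _)) /le_trans; apply.
by rewrite eseries0 // => i _ _; exact: F0.
Qed.

Lemma null_setU A B : nu A = 0 -> nu B = 0 -> nu (A `|` B) = 0.
Proof.
by move=> A0 B0; rewrite -bigcup2E; apply: null_bigcup => -[|[|n]] //=; rewrite measure0.
Qed.

Lemma not_null_ex A : nu A != 0 -> exists x, A x.
Proof.
by move=> A0; apply/not_existsP => h; move/eqP: A0; apply; rewrite (_ : A = set0) ?measure0//;
  apply/seteqP; split.
Qed.

Lemma probT_neq0 : nu setT != 0.
Proof. by rewrite probability_setT onee_neq0. Qed.

Lemma null_setC A : nu A = 0 -> nu (~` A) = 1.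
Proof. by move=> A0; rewrite probability_setC// A0 sube0. Qed.

(* A set of indices is small when it plays the role of a cardinal below the additivity
   of [nu]. *)
Record small (I : Type) (Q : set I) : Prop := Small { smallP : forall N : I -> set T,
  (forall q, Q q -> nu (N q) = 0) -> nu (\bigcup_(q in Q) N q) = 0 }.

Lemma small_sub (I : Type) (Q Q' : set I) : Q `<=` Q' -> small Q' -> small Q.
Proof.
move=> QQ' sQ'; split=> N N0.
have := smallP sQ' (fun q => if `[< Q q >] then N q else set0).
move=> h; apply: (null_sub _ (h _)).
  by move=> x [q Qq Nx]; exists q; [exact: QQ'|rewrite asboolT].
by move=> q _; case: asboolP => [/N0//|]; rewrite measure0.
Qed.

Lemma small_image (I J : Type) (f : I -> J) (Q : set I) : small Q -> small (f @` Q).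
Proof.
move=> sQ; split=> N N0; apply: (null_sub _ (smallP sQ (fun q => N (f q)) _)).
  by move=> x [_ [q Qq <-] Nx]; exists q.
by move=> q Qq; apply: N0; exists q.
Qed.

Lemma small_inj (I J : Type) (f : I -> J) (Q : set I) : injective f -> small (f @` Q) -> small Q.
Proof.
move=> fi sQ; split=> N N0.
apply: (null_sub _ (smallP sQ (fun j => [set x | exists2 q, f q = j & Q q /\ N q x]) _)).
  by move=> x [q Qq Nx]; exists (f q); [exists q|exists q].
by move=> _ [q Qq <-]; apply: (null_sub _ (N0 q Qq)) => x [q' /fi -> []].
Qed.

Lemma small_bigcup (I : Type) (Q : nat -> set I) : (forall n, small (Q n)) -> small (\bigcup_n Q n).
Proof.
move=> sQ; split=> N N0.
have h n : nu (\bigcup_(q in Q n) N q) = 0 by apply: (smallP (sQ n)) => q Qq; apply: N0; exists n.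
apply: (null_sub _ (null_bigcup _ h)).
by move=> x [q [n _ Qq] Nx]; exists n => //; exists q.
Qed.

Lemma small_set1 (I : Type) (i : I) : small [set i].
Proof. by split=> N N0; rewrite bigcup_set1; exact: N0. Qed.

Lemma small_countable (I : Type) (Q : set I) : countable Q -> small Q.
Proof.
move=> /countable_injP [f fi]; split=> N N0.
have h n : nu ([set x | exists q, [/\ Q q, f q = n & N q x]]) = 0.
  have [[q [Qq qn]]|nq] := pselect (exists q, Q q /\ f q = n).
    apply: (null_sub _ (N0 q Qq)) => x [q' [Qq' q'n Nx]].
    by rewrite (_ : q = q')//; apply: fi; rewrite ?inE ?qn.
  by apply: (null_sub _ (measure0 nu)) => x [q [Qq qn _]]; apply: nq; exists q.
apply: (null_sub _ (null_bigcup _ h)).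
by move=> x [q Qq Nx]; exists (f q) => //; exists q.
Qed.

Lemma small_pair (I J : Type) (P : set I) (Q : set J) : small P -> small Q ->
  small [set ij : I * J | P ij.1 /\ Q ij.2].
Proof.
move=> sP sQ; split=> N N0.
apply: (null_sub _ (smallP sP (fun i => \bigcup_(j in Q) N (i, j)) _)).
  by move=> x [[i j] [/= Pi Qj] Nx]; exists i => //; exists j.
by move=> i Pi; apply: (smallP sQ) => j Qj; exact: N0.
Qed.

(** Closure under finite sequences makes the codes used later, lists over an initial segment, a
    small family. *)
Lemma small_seq (I : Type) (Q : set I) : small Q -> small [set s : seq I | List.Forall Q s].
Proof.
move=> sQ.
rewrite (_ : mkset _ = \bigcup_n [set s : seq I | size s = n /\ List.Forall Q s]); last first.
  by apply/seteqP; split => [s h|s [n _ []]] //; exists (size s).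
apply: small_bigcup; elim => [|n IH].
  by apply: (@small_sub _ _ [set (@nil I)] _ (small_set1 _)) => -[|x s] [].
apply: (small_sub _ (small_image (fun ij : I * seq I => ij.1 :: ij.2) (small_pair sQ IH))).
move=> [|x s] [] //= [sn] h; exists (x, s) => //=.
by have := @List.Forall_cons_iff _ Q x s => -[/(_ h) [? ?] _].
Qed.

End DiscrMeasure.

Lemma wf_min (T : Type) (lt : T -> T -> Prop) : well_founded lt ->
  forall A : set T, A !=set0 -> exists2 x, A x & forall y, A y -> ~ lt y x.
Proof.
move=> wf A [x]; elim/(well_founded_ind wf): x => x IH Ax.
have [[y [Ay yx]]|h] := pselect (exists y, A y /\ lt y x); first exact: (IH y).
by exists x => // y Ay yx; apply: h; exists y.
Qed.

Lemma well_order_lt (T : Type) : exists lt : T -> T -> Prop,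
  [/\ well_founded lt, forall x y z, lt x y -> lt y z -> lt x z &
      forall x y, [\/ lt x y, x = y | lt y x]].
Proof.
have [[t0]|T0] := pselect (inhabited T); last first.
  by exists (fun _ _ => False); split => // x; case: T0; exists.
have [r wo] := wochoice.well_ordering_principle (ptd t0).
have rmin (A : set T) : A !=set0 -> exists z, [/\ A z, forall x, A x -> r z x &
    forall z', A z' -> (forall x, A x -> r z' x) -> z = z'].
  move=> [x Ax]; have [|z [[Az zm] zu]] := wo [pred y : ptd t0 | `[< A y >]].
    by exists x; apply/asboolP.
  exists z; split; first by move: Az => /asboolP.
    by move=> y Ay; apply: zm; apply/asboolP.
  move=> z' Az' z'm; apply: zu; split; first exact/asboolP.
  by move=> y /asboolP; exact: z'm.
have rxx x : r x x.
  by have [|z [-> zm _]] := rmin [set x]; [exists x|exact: zm].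
have anti x y : r x y -> r y x -> x = y.
  move=> xy yx; have [|z [_ _ zu]] := rmin [set w | w = x \/ w = y]; first by exists x; left.
  have zx : z = x by apply: zu; [left|move=> w [->|->]].
  have zy : z = y by apply: zu; [right|move=> w [->|->]].
  by rewrite -zx.
have tot x y : r x y \/ r y x.
  have [|z [[zx|zy] zm _]] := rmin [set w | w = x \/ w = y]; first by exists x; left.
    by left; rewrite -zx; apply: zm; right.
  by right; rewrite -zy; apply: zm; left.
have tr x y z : r x y -> r y z -> r x z.
  move=> xy yz.
  have [|w [[wx|wy|wz] wm _]] := rmin [set w | [\/ w = x, w = y | w = z]].
  - by exists x; constructor 1.
  - by rewrite -wx; apply: wm; constructor 3.
  - have yx : r y x by rewrite -wy; apply: wm; constructor 1.
    by rewrite (anti _ _ xy yx).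
  - have zy : r z y by rewrite -wz; apply: wm; constructor 2.
    by rewrite -(anti _ _ yz zy).
exists (fun x y => x <> y /\ r x y); split.
- move=> x; apply: contrapT => nx.
  have [|z [nz zm _]] := rmin [set y | ~ Acc (fun x y => x <> y /\ r x y) y].
    by exists x.
  apply: nz; constructor => y [yz ryz]; apply: contrapT => ny.
  by apply: yz; apply: anti => //; exact: zm.
- move=> x y z [xy rxy] [yz ryz]; split; last exact: tr ryz.
  by move=> xz; subst z; apply: xy; exact: anti.
- move=> x y; have [->|xy] := pselect (x = y); first by constructor 2.
  by have [rxy|ryx] := tot x y; [constructor 1|constructor 3; split => // /esym].
Qed.

(** Recursion by a relation instead of a function: [P x] looks only at the values below [x], so the
    value at [x] may be chosen after extending the earlier ones by the default [l0]. *)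
Lemma wf_recursion (S L : Type) (lt : S -> S -> Prop) (P : S -> (S -> L) -> L -> Prop) :
  inhabited L -> well_founded lt ->
  (forall x f g j, (forall y, lt y x -> f y = g y) -> P x f j -> P x g j) ->
  (forall x f, exists j, P x f j) -> exists e : S -> L, forall x, P x e (e x).
Proof.
move=> [l0] wf loc ex.
pose ext x (rec : forall y, lt y x -> L) y := if pselect (lt y x) is left h then rec y h else l0.
pose F x (rec : forall y, lt y x -> L) := projT1 (cid (ex x (ext x rec))).
pose e := Fix wf (fun _ => L) F.
exists e => x.
have -> : e x = F x (fun y _ => e y).
  rewrite /e Fix_eq// => z f g fg; congr (F z _).
  by apply: functional_extensionality_dep => y; apply: functional_extensionality_dep => h.
rewrite /F; case: cid => j /=; apply: loc => y yx.
by rewrite /ext; case: pselect.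
Qed.

Section SmallOrder.
Local Open Scope ereal_scope.
Variables (R : realType) (K : Type) (x0 : K) (nu : probability (discr x0) R).
Variable lt : K -> K -> Prop.

Definition diffuse := forall x, nu [set x] = 0.

(** Stands for the initial order of a real-valued measurable cardinal. *)
Definition small_order := [/\ well_founded lt, forall x y z, lt x y -> lt y z -> lt x z,
  forall x y, [\/ lt x y, x = y | lt y x] & forall x, small nu [set y | lt y x]].

Hypotheses (so : small_order) (dn : diffuse).

(** At stage [x] choose a point of [J] that is not a value at an earlier stage; one remains because
    those values do not cover [J]. *)
Lemma inject_not_covered (L : Type) (J : set L) : J !=set0 ->
  (forall (f : K -> L) x, ~ (J `<=` f @` [set y | lt y x])) ->
  exists e : K -> L, injective e /\ forall x, J (e x).
Proof.
move=> [l0 Jl0] ncov; have [wf _ tot _] := so.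
have [||x f g j fg [Jj h]|x f|e eP] := @wf_recursion K L lt
    (fun x f j => J j /\ forall y, lt y x -> f y <> j).
- by exists.
- exact: wf.
- by split => // y yx; rewrite -fg//; exact: h.
- apply: contrapT => nex; apply: (ncov f x) => j Jj.
  apply: contrapT => nj; apply: nex; exists j; split => // y yx fyj.
  by apply: nj; exists y.
exists e; split; last by move=> x; case: (eP x).
move=> x y exy; have [xy|//|yx] := tot x y.
- by have [_ h] := eP y; case: (h _ xy).
- by have [_ h] := eP x; case: (h _ yx).
Qed.

Lemma inject_not_small (L : Type) (J : set L) : ~ small nu J ->
  exists e : K -> L, injective e /\ forall x, J (e x).
Proof.
move=> nsJ; have [_ _ _ sm] := so; apply: inject_not_covered.
  apply/set0P/eqP => J0; apply: nsJ; rewrite J0; split => N _; rewrite bigcup_set0 measure0//.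
by move=> f x cov; apply: nsJ; apply: (small_sub cov); exact: (small_image f (sm x)).
Qed.

(** A family of null sets with a non-null union is not small, so [K] injects into it; a family of
    fewer than [K] sets admits no such injection. *)
Lemma small_order_rvm : real_valued_measurable R K.
Proof.
exists (fun A => fine (nu A)); split.
- by move=> A; exact: fine_ge0.
- by have -> : nu [set: K] = 1 by exact: probability_setT.
- move=> F tF.
  have h : (fun n => \sum_(0 <= i < n) nu (F i)) @ \oo --> nu (\bigcup_n F n).
    exact: measure_semi_sigma_additive.
  have finF A : nu A \is a fin_num by exact: fin_num_measure.
  move: h; rewrite -(fineK (finF (\bigcup_n F n))) => /fine_cvgP[_].
  rewrite (_ : fine \o _ = (fun n => \sum_(i < n) fine (nu (F i)))%R)//.
  apply/funext => n /=; rewrite big_mkord.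
  by rewrite -sum_fine// => i _.
- by move=> x; rewrite dn.
- move=> Fam [_ nle] Fam0; apply: contra_notP nle => h.
  have : ~ small nu Fam.
    move=> sF; apply: h; rewrite (smallP sF id)// => A FA.
    by rewrite -[LHS]fineK ?Fam0// fin_num_measure.
  move=> /inject_not_small[e [ei eF]].
  rewrite -(card_le_eql (inj_card_eq (f := e) _)); last by move=> x y _ _; exact: ei.
  by apply: subset_card_le => _ [x _ <-].
Qed.

End SmallOrder.

Lemma rvm_probability (R : realType) (K : Type) : real_valued_measurable R K ->
  exists (x0 : K) (m : probability (discr x0) R), diffuse m.
Proof.
move=> [mu [mu0 mu1 mus mud _]].
(* The partial sums of the constant sequence converge, so their increments, all equal to [mu set0],
   tend to zero. *)
have muset0 : mu set0 = 0.
  have tF : trivIset setT (fun _ : nat => @set0 K) by apply/trivIsetP => i j _ _ _; rewrite set0I.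
  have := mus _ tF; rewrite bigcup0// => h.
  have h1 : (\sum_(i < n.+1) mu set0) @[n --> \oo] --> mu set0.
    by rewrite -(cvg_shiftS (fun n => \sum_(i < n) mu set0)) in h.
  have h2 : (fun n => \sum_(i < n.+1) mu set0 - \sum_(i < n) mu set0) @ \oo --> mu set0 - mu set0.
    exact: cvgB.
  rewrite subrr in h2.
  have h3 : (fun n => \sum_(i < n.+1) mu set0 - \sum_(i < n) mu set0) = cst (mu set0).
    by apply/funext => n; rewrite big_ord_recr /=; rewrite addrAC subrr add0r.
  by rewrite h3 in h2; apply/esym; apply: cvg_unique h2 (cvg_cst _).
have [x0 _] : [set: K] !=set0.
  by apply/set0P/eqP => h; move: mu1; rewrite h muset0 => /eqP; rewrite eq_sym oner_eq0.
exists x0.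
have [||||m mE] := @mkprob_ex _ (discr x0) R (fun A => (mu A)%:E).
- by rewrite muset0.
- by move=> A; rewrite lee_fin.
- move=> F _ tF _; apply/fine_cvgP; split.
    by apply: nearW => n; rewrite sumEFin.
  rewrite (_ : fine \o _ = (fun n => \sum_(i < n) mu (F i))); first exact: mus.
  by apply/funext => n /=; rewrite sumEFin big_mkord.
- exact: (congr1 EFin mu1).
by exists m => x; rewrite mE mud.
Qed.

Section Extract.
Local Open Scope ereal_scope.

(** [X] is not small, because singletons are null. [S] is [X] itself or its part below the first
    point at which initial segments of [X] stop being small. As [S] is not small, some null sets
    [N q] indexed by it have a non-null union [U]. Sending each point of [U] to a [q] whose [N q]
    contains it carries the conditional measure on [U] to [S]; the image is diffuse because each
    fibre lies in a null set. *)
Lemma small_order_extract (R : realType) (T : Type) (x0 : T) (m : probability (discr x0) R)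
    (X : set T) : diffuse m -> m (~` X) = 0 ->
  exists (S : set T) (s0 : {x | S x}) (nu : probability (discr s0) R)
    (lt : {x | S x} -> {x | S x} -> Prop),
  [/\ S `<=` X, diffuse nu & small_order nu lt].
Proof.
move=> dm Xfull.
have [lt [wf tr tot]] := well_order_lt T.
have [S [SX nsS Ssm]] : exists S : set T, [/\ S `<=` X, ~ small m S &
    forall y, S y -> small m [set z | S z /\ lt z y]].
  have [[x nx]|allsm] := pselect (exists x, ~ small m [set y | X y /\ lt y x]).
    have [|x1 nx1 minx1] := wf_min wf (A := [set x | ~ small m [set y | X y /\ lt y x]]).
      by exists x.
    exists [set y | X y /\ lt y x1]; split => //; first by move=> y [].
    move=> y [Xy yx1]; apply: (small_sub (Q' := [set z | X z /\ lt z y])).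
      by move=> z [[]].
    by apply: contrapT => /minx1; apply.
  exists X; split => //.
    move=> sX; have := smallP sX (fun x => [set x]) (fun x _ => dm x).
    move=> sX0; have : m ([set: T] : set T) = 0.
      apply: (null_sub m _ (null_setU m _ _ sX0 Xfull)) => x _.
      by have [Xx|nXx] := pselect (X x); [left; exists x|right].
    by rewrite probability_setT => /eqP; rewrite onee_eq0.
  move=> y Xy; apply: contrapT => h; apply: allsm; by exists y.
have [N [N0 U0]] : exists N : T -> set T, (forall q, S q -> m (N q) = 0) /\
    m (\bigcup_(q in S) N q) != 0.
  apply: contrapT => nex; apply: nsS; split=> N N0; apply/eqP/negPn/negP => U0.
  by apply: nex; exists N.
set U := \bigcup_(q in S) N q in U0.
have [s0] : inhabited {x | S x}.
  have [z [q Sq _]] := not_null_ex m _ U0; exact: (inhabits (exist _ q Sq)).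
have [f fP] : exists f : T -> {x | S x}, forall z, U z -> N (proj1_sig (f z)) z.
  have h z : exists q : {x | S x}, U z -> N (proj1_sig q) z.
    have [[q Sq Nz]|nU] := pselect (U z); first by exists (exist _ q Sq).
    by exists s0.
  by exists (fun z => projT1 (cid (h z))) => z; case: cid.
have Uoo : m U < +oo by rewrite -ge0_fin_numE// fin_num_measure.
have [nu nuE] := @measure_condition_pushforward _ (discr s0) R _ _ m U f
  (@discr_measurable T x0 U) U0 Uoo (@discr_measurable_fun T x0 _ (discr s0) U f).
have finU : m U \is a fin_num by rewrite ge0_fin_numE.
have nu0 A : nu A = 0 <-> m (f @^-1` A `&` U) = 0.
  have -> : nu A = m (f @^-1` A `&` U) * (fine (m U))^-1%:E := nuE A.
  split=> [/eqP|->]; last by rewrite mul0e.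
  by rewrite mule_eq0 => /orP[/eqP//|]; rewrite eqe invr_eq0 fine_eq0// (negbTE U0).
exists S, s0, nu, (fun a b => lt (proj1_sig a) (proj1_sig b)); split; first exact: SX.
  move=> q; apply/nu0; apply: (null_sub m _ (N0 (proj1_sig q) (proj2_sig q))).
  by move=> z [/= <-]; exact: fP.
split.
- have h x : forall a : {x | S x}, proj1_sig a = x ->
      Acc (fun a b : {x | S x} => lt (proj1_sig a) (proj1_sig b)) a.
    elim/(well_founded_ind wf): x => x IH a ax; constructor => b.
    by rewrite ax => bx; exact: (IH _ bx).
  by move=> a; exact: (h _ a erefl).
- by move=> a b c; exact: tr.
- move=> [a Sa] [b Sb] /=; have [ab|ab|ba] := tot a b.
  + by constructor 1.
  + by subst b; constructor 2; congr exist; exact: Prop_irrelevance.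
  + by constructor 3.
- move=> [y Sy] /=; split=> N' N'0; apply/nu0.
  have sm1 : small m [set b : {x | S x} | lt (proj1_sig b) y].
    apply: (small_inj (f := (fun b : {x | S x} => proj1_sig b))).
      by move=> [a Sa] [b Sb] /= e; subst b; congr exist; exact: Prop_irrelevance.
    by apply: (small_sub _ (Ssm y Sy)) => _ [[b Sb] /= by' <-].
  have := smallP sm1 (fun b => f @^-1` (N' b) `&` U).
  rewrite -setI_bigcupl -preimage_bigcup; apply.
  by move=> b by'; apply/nu0; exact: N'0.
Qed.

End Extract.

(** * Supports of Borel measures *)

Section DisjointNotNull.
Import finmap.

Lemma countable_disjoint_not_null d (X : measurableType d) (R : realType)
    (mu : probability X R) (I : Type) (D : set I) (F : I -> set X) :
  (forall i, D i -> measurable (F i)) ->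
  (forall i j, D i -> D j -> i <> j -> F i `&` F j = set0) ->
  (forall i, D i -> mu (F i) != 0%E) -> countable D.
Proof.
move=> mF dF F0; have [[i0 Di0]|D0] := pselect (exists i, D i); last first.
  by rewrite (_ : D = set0)//; apply/seteqP; split => // i Di; case: D0; exists i.
have cm m : countable [set i : ptd i0 | D i /\ ((m.+1%:R^-1)%:E <= mu (F i))%E].
  apply: finite_set_countable; apply: contrapT => /(@infinite_set_fset _ _ m.+2)[B BD sB].
  have mB i : i \in B -> measurable (F i) by move=> /BD [Di _]; exact: mF.
  have tB : trivIset [set` B] F.
    apply/trivIsetP => i j /BD [Di _] /BD [Dj _] /eqP; exact: dF.
  have := measure_fbigsetU mu mB tB.
  have le1 : (mu (\big[setU/set0]_(i <- B) F i) <= 1)%E.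
    by apply: probability_le1; rewrite big_seq; apply: bigsetU_measurable => i; exact: mB.
  move=> e; move: le1; rewrite e; apply/negP; rewrite -ltNge.
  apply: (@lt_le_trans _ _ (\sum_(i <- B) (m.+1%:R^-1)%:E)%E); last first.
    rewrite big_seq [X in (_ <= X)%E]big_seq; apply: lee_sum => i /BD[] //.
  rewrite sumEFin lte_fin big_const_seq iter_addr_0 count_predT.
  rewrite -(@mulr_natl _ m.+1%:R^-1) ltr_pdivlMr// mul1r ltr_nat.
  exact: sB.
apply: (@sub_countable _ _ D (\bigcup_m [set i : ptd i0 | D i /\ ((m.+1%:R^-1)%:E <= mu (F i))%E])).
  apply: subset_card_le => i Di.
  have : (0 < fine (mu (F i)))%R.
    by rewrite fine_gt0// lt0e F0//= measure_ge0/= ltey_eq fin_num_measure//; exact: mF.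
  move=> h; have [m mh] := ltr_add_invr h; rewrite add0r in mh.
  exists m => //; split => //.
  have fi : mu (F i) \is a fin_num by rewrite fin_num_measure//; exact: mF.
  by rewrite -(fineK fi) lee_fin; exact: ltW.
apply: bigcup_countable => // m _; exact: cm.
Qed.

End DisjointNotNull.

Section Separated.
Variables (R : realType) (T : Type) (d : T -> T -> R).
Hypothesis dm : is_metric d.

(** Go through the space along a well-order and keep a point of [W] when it is at distance at least
    [e] from all points kept before. *)
Lemma maximal_separated (W : set T) (e : R) : exists X : set T,
  [/\ X `<=` W, forall x y, X x -> X y -> x <> y -> e <= d x y &
      forall w, W w -> 0 < e -> exists2 x, X x & d w x < e].
Proof.
have [lt [wf _ tot]] := well_order_lt T.
have [||x f g j fg|x f|X XP] := @wf_recursion T Prop lt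
  (fun x f j => j <-> W x /\ forall y, lt y x -> f y -> e <= d x y).
- exact: (inhabits True).
- exact: wf.
- move=> ->; split=> -[Wx h]; split => // y yx; first by rewrite -fg//; exact: h.
  by rewrite fg//; exact: h.
- by exists (W x /\ forall y, lt y x -> f y -> e <= d x y).
exists X; split.
- by move=> x /XP[].
- move=> x y Xx Xy xy; have [xy'|//|yx] := tot x y.
    by rewrite (metric_sym dm); have [_] := (XP y).1 Xy; exact.
  by have [_] := (XP x).1 Xx; exact.
- move=> w Ww e0; have [Xw|nXw] := pselect (X w); first by exists w => //; rewrite metric_refl.
  apply: contrapT => h; apply: nXw; apply/XP; split => // y yw Xy.
  by rewrite leNgt; apply/negP => wy; apply: h; exists y.
Qed.

Lemma metric_closed_measurable (x0 : T) (C : set T) :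
  (forall y, (forall e, 0 < e -> exists2 z, C z & d y z < e) -> C y) ->
  measurable (C : set (g_sigma_algebraType (@metric_open R (ptd x0) d))).
Proof.
move=> cC; rewrite -[C]setCK; apply: measurableC; apply: metric_open_measurable => y nCy.
apply: contrapT => h; apply: nCy; apply: cC => e e0; apply: contrapT => nz.
by apply: h; exists e => // z /= yz Cz; apply: nz; exists z.
Qed.

End Separated.

Section Support.
Variables (R : realType) (T : Type) (d : T -> T -> R) (x0 : T).
Hypothesis dm : is_metric d.
Local Notation B := (g_sigma_algebraType (@metric_open R (ptd x0) d)).
Variable mu : probability B R.

Definition null_part : set T := [set x | exists2 r, 0 < r & mu [set y | d x y < r] = 0%E].

Lemma measurable_null_part : measurable (null_part : set B).
Proof.
apply: metric_open_measurable => x [r r0 h]; exists (r / 2); first by rewrite divr_gt0.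
move=> y /= xy; exists (r / 2); first by rewrite divr_gt0.
apply/eqP; rewrite -measure_le0 -h; apply: le_measure.
- apply/mem_set; apply: metric_open_measurable; exact: metric_open_ball.
- apply/mem_set; apply: metric_open_measurable; exact: metric_open_ball.
- move=> z /= yz; have := metric_tri dm x y z; lra.
Qed.

(** Around the points of a maximal separated subset of the support, the balls of half the separation
    are disjoint and not null, hence countably many. *)
Lemma support_separable : metric_separable (sub_metric d (~` null_part)).
Proof.
have [X XP] : exists X : nat -> set T, forall n, [/\ X n `<=` ~` null_part,
    forall x y, X n x -> X n y -> x <> y -> n.+1%:R^-1 <= d x y &
      forall w, ~ null_part w -> exists2 x, X n x & d w x < n.+1%:R^-1].
  have h n : exists X : set T, [/\ X `<=` ~` null_part,
    forall x y, X x -> X y -> x <> y -> n.+1%:R^-1 <= d x y &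
      forall w, ~ null_part w -> exists2 x, X x & d w x < n.+1%:R^-1].
    have [X [h1 h2 h3]] := maximal_separated dm (~` null_part) n.+1%:R^-1.
    by exists X; split => // w /h3; apply.
  by exists (fun n => projT1 (cid (h n))) => n; case: cid.
have cX n : countable (X n).
  have [Xs Xsep _] := XP n.
  apply: (@countable_disjoint_not_null _ _ _ mu _ (X n)
    (fun x => [set y | d x y < n.+1%:R^-1 / 2])).
  - by move=> x _; apply: metric_open_measurable; exact: metric_open_ball.
  - move=> x y Xx Xy xy; apply/seteqP; split => // z [/= xz yz].
    have := Xsep _ _ Xx Xy xy; have := metric_tri dm x z y; rewrite (metric_sym dm z).
    by move: xz yz; set t := n.+1%:R^-1; lra.
  - move=> x Xx; apply/negP => /eqP h; apply: (Xs _ Xx).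
    by exists (n.+1%:R^-1 / 2) => //; rewrite divr_gt0.
exists (fun x => exists n, X n (proj1_sig x)); split.
  have -> : (fun x : {x | (~` null_part) x} => exists n, X n (proj1_sig x)) =
      \bigcup_n [set x | X n (proj1_sig x)].
    by apply/seteqP; split => [x [n Xx]|x [n _ Xx]]; exists n.
  apply: bigcup_countable => // n _.
  have /countable_injP[f fi] := cX n; apply/countable_injP.
  exists (fun x => f (proj1_sig x)) => -[x nx] [y ny] /set_mem /= Xx /set_mem /= Xy xy.
  have e : x = y by apply: fi => //; exact/mem_set.
  by subst y; congr exist; exact: Prop_irrelevance.
move=> [x nx] r r0; have [n nr] := ltr_add_invr r0; rewrite add0r in nr.
have [Xs _ Xd] := XP n; have [y Xy xy] := Xd x nx.
exists (exist _ y (Xs _ Xy)); first by exists n.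
by rewrite /sub_metric /=; exact: lt_trans nr.
Qed.

(* Each point of the null part is assigned to the least centre, for a well-order of the
   space, of a null ball containing it.  The pieces [A n] of a centre are then at distance at
   least [1/n] from the pieces of another centre, so that every union of such pieces is
   closed and [mu] induces a measure defined on all sets of centres. *)
Lemma null_part_null :
  (forall K : Type, real_valued_measurable R K ->
      exists D : set T, metric_dense d D /\ card_lt D [set: K]) ->
  mu (null_part : set B) = 0%E.
Proof.
move=> small_dense; have [lt [wf _ tot]] := well_order_lt T.
have [r rP] : exists r : T -> R, forall x, null_part x ->
    0 < r x /\ mu [set y | d x y < r x] = 0%E.
  have h x : exists r, null_part x -> 0 < r /\ mu [set y | d x y < r] = 0%E.
    have [[r r0 m0]|nx] := pselect (null_part x); first by exists r.
    by exists 0 => /nx.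
  by exists (fun x => projT1 (cid (h x))) => x; case: cid.
have [al alP] : exists al : T -> T, forall y, null_part y ->
    [/\ null_part (al y), d (al y) y < r (al y) &
      forall z, null_part z -> d z y < r z -> ~ lt z (al y)].
  have h y : exists x, null_part y ->
    [/\ null_part x, d x y < r x & forall z, null_part z -> d z y < r z -> ~ lt z x].
    have [Vy|nVy] := pselect (null_part y); last by exists y.
    have [|x [Vx xy] xm] := wf_min wf (A := [set x | null_part x /\ d x y < r x]).
      by exists y; split => //; rewrite metric_refl//; case: (rP _ Vy).
    by exists x => _; split => // z Vz zy; exact: xm.
  by exists (fun x => projT1 (cid (h x))) => x; case: cid.
pose A n : set T := [set y | null_part y /\ d (al y) y <= r (al y) - n.+1%:R^-1].
have Asep n y y' : A n y -> A n y' -> al y <> al y' -> n.+1%:R^-1 <= d y y'.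
  have ws u v : A n u -> A n v -> lt (al u) (al v) -> n.+1%:R^-1 <= d u v.
    move=> [Vu ru] [Vv rv] uv; have [_ _ vm] := alP v Vv; have [Vau _ _] := alP u Vu.
    have : ~ d (al u) v < r (al u) by move=> /(vm _ Vau).
    move=> /negP; rewrite -leNgt => h; have := metric_tri dm (al u) u v.
    by move: ru; set t := n.+1%:R^-1; lra.
  move=> Ay Ay' ne; have [yy'|//|y'y] := tot (al y) (al y'); first exact: ws.
  by rewrite (metric_sym dm); exact: ws.
(* This set is closed: its elements close to a limit point [y] all have one centre, and this centre
   is [al y]. An [al y] preceding it would also serve elements close to [y]; the opposite order
   contradicts minimality at [y]. *)
have mA n (I : set T) : measurable (A n `&` al @^-1` I : set B).
  apply: metric_closed_measurable => y cl; pose e : R := n.+1%:R^-1.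
  have e0 : 0 < e by rewrite invr_gt0.
  have [z1 [Az1 Iz1] yz1] := cl (e / 2) (divr_gt0 e0 (ltr0Sn _ 1)).
  have alz z : A n z -> d y z < e / 2 -> al z = al z1.
    move=> Az yz; apply: contrapT => ne; have := Asep _ _ _ Az Az1 ne.
    have := metric_tri dm z y z1; rewrite (metric_sym dm z y) -/e; lra.
  have near f : 0 < f -> exists2 z, [/\ null_part z, al z = al z1 & d (al z1) z <= r (al z1) - e] &
      d y z < f.
    move=> f0; have [|z [Az _] yz] := cl (Num.min f (e / 2)).
      by rewrite lt_min f0 divr_gt0.
    move: yz; rewrite lt_min => /andP[yf ye]; exists z => //.
    by have [Vz rz] := Az; rewrite -(alz z Az ye).
  have dy : d (al z1) y <= r (al z1) - e.
    apply/ler_addgt0Pr => f f0; have [z [_ _ rz] yz] := near f f0.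
    have := metric_tri dm (al z1) z y; rewrite (metric_sym dm z y); lra.
  have [Va1 _ _] := alP _ Az1.1.
  have Vy : null_part y.
    have [ra m0] := rP _ Va1; exists e => //; apply/eqP; rewrite -measure_le0 -m0.
    apply: le_measure.
    + by apply/mem_set; apply: metric_open_measurable; exact: metric_open_ball.
    + by apply/mem_set; apply: metric_open_measurable; exact: metric_open_ball.
    + by move=> z /= yz; have := metric_tri dm (al z1) y z; lra.
  have [Vay dyr ym] := alP y Vy.
  suff ay : al y = al z1 by split; [split => //; rewrite ay|rewrite /= ay].
  have [h|//|h] := tot (al y) (al z1).
  - have [|z [Vz az _] yz] := near (r (al y) - d (al y) y); first by rewrite subr_gt0.
    have [_ _ zm] := alP z Vz; case: (zm (al y) Vay); last by rewrite az.
    have := metric_tri dm (al y) y z; lra.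
  - by case: (ym (al z1) Va1); first by lra.
apply: contrapT => V0.
have [n An0] : exists n, mu (A n : set B) != 0%E.
  apply: contrapT => h; apply: V0.
  have : mu.-negligible (\bigcup_n (A n : set B)).
    apply: negligible_bigcup => n; apply/negligibleP.
      by have := mA n setT; rewrite preimage_setT setIT.
    by apply/eqP/negPn/negP => h'; apply: h; exists n.
  move=> /(negligibleS _) h'; apply/negligibleP; first exact: measurable_null_part.
  apply: h' => y Vy; have [_ dy _] := alP y Vy.
  have : 0 < r (al y) - d (al y) y by rewrite subr_gt0.
  move=> /ltr_add_invr[n nh]; exists n => //; split => //.
  by move: nh; set t := n.+1%:R^-1; lra.
have mAn : measurable (A n : set B) by have := mA n setT; rewrite preimage_setT setIT.
have [m mE] := @measure_condition_pushforward _ (discr x0) R _ _ mu (A n) al mAn An0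
  (ltac:(by rewrite ltey_eq fin_num_measure)) (fun _ Y _ => mA n Y).
have mIE (I : set T) : m I = (mu (al @^-1` I `&` A n) * (fine (mu (A n)))^-1%:E)%E := mE I.
have dfm : diffuse m.
  move=> x; have [Vx|nVx] := pselect (null_part x); last first.
    rewrite mIE (_ : _ `&` _ = set0) ?measure0 ?mul0e//.
    by apply/seteqP; split => // z [/= ax [Vz _]]; apply: nVx; rewrite -ax; case: (alP _ Vz).
  rewrite mIE (_ : mu _ = 0%E) ?mul0e//; have [_ m0] := rP _ Vx.
  apply/eqP; rewrite -measure_le0 -m0; apply: le_measure.
  - by apply/mem_set; rewrite setIC; exact: mA.
  - by apply/mem_set; apply: metric_open_measurable; exact: metric_open_ball.
  - by move=> z [/= <- [Vz _]]; case: (alP _ Vz).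
have [|S [s0 [nu [lt' [SX dnu so]]]]] := @small_order_extract R T x0 m (al @` A n) dfm.
  rewrite mIE (_ : _ `&` _ = set0) ?measure0 ?mul0e//.
  by apply/seteqP; split => // z [/= h Az]; apply: h; exists z.
have [D [denseD [_ nle]]] := small_dense _ (small_order_rvm so dnu).
apply: nle.
(* The radius is half the separation of the pieces, so that distinct centres get distinct points of
   [D]. *)
have [a aP] : exists a : {x | S x} -> T, forall x, D (a x) /\
    exists y, [/\ A n y, al y = proj1_sig x & d y (a x) < n.+1%:R^-1 / 2].
  have h (x : {x | S x}) : exists a, D a /\
      exists y, [/\ A n y, al y = proj1_sig x & d y a < n.+1%:R^-1 / 2].
    have [y Ay yx] := SX _ (proj2_sig x).
    have [|p Dp yp] := denseD y (n.+1%:R^-1 / 2); first by rewrite divr_gt0.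
    by exists p; split => //; exists y.
  by exists (fun x => projT1 (cid (h x))) => x; case: cid.
have ai : injective a.
  move=> x x' xx'; have [_ [y [Ay yx ya]]] := aP x; have [_ [y' [Ay' yx' ya']]] := aP x'.
  have e : proj1_sig x = proj1_sig x'.
    apply: contrapT; rewrite -yx -yx' => ne; have := Asep _ _ _ Ay Ay' ne.
    have := metric_tri dm y (a x) y'; rewrite (metric_sym dm (a x)) [in d y' _]xx'.
    by move: ya ya'; set t := n.+1%:R^-1; lra.
  move: x x' e {xx' yx ya yx' ya'} => [x Sx] [x' Sx'] /= e; subst x'.
  by congr exist; exact: Prop_irrelevance.
rewrite -(card_le_eql (inj_card_eq (f := a) _)); last by move=> x y _ _; exact: ai.
by apply: subset_card_le => _ [x _ <-]; case: (aP x).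
Qed.

End Support.

(** * Transfer of consistency between a space and its separable subspaces *)

Section Sufficiency.
Variables (R : realType) (T : Type) (d : T -> T -> R) (k : nat -> nat).
Hypothesis dm : is_metric d.

Lemma knn_univ_consistent_separable_subspace (S : set T) :
  knn_univ_consistent d k -> metric_separable (sub_metric d S) ->
  knn_univ_consistent (sub_metric d S) k.
Proof.
move=> cT sepS s0 P'; pose x0 := proj1_sig s0.
have [|P PE] := @probability_pushforward _ (BorelLab d x0) R _ _ P'
    (fun z => (proj1_sig z.1, z.2)).
  apply: measurable_fun_pair => /=; last exact: measurable_snd.
  exact: (measurableT_comp (@measurable_sval R T d S x0 s0) measurable_fst).
apply/(knn_consistent_subspace dm sepS (P := P)); last exact: cT.
by move=> A mA; exact: PE.
Qed.

(** The map [rho] retracts the space onto the support, with a default value on the null set [V]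
    alone. So [P] is the image under the inclusion of its own image under [rho], and consistency on
    the support carries over. *)
Lemma knn_univ_consistent_of_separable_subspaces :
  (forall S : set T, metric_separable (sub_metric d S) -> knn_univ_consistent (sub_metric d S) k) ->
  (forall K : Type, real_valued_measurable R K ->
      exists D : set T, metric_dense d D /\ card_lt D [set: K]) ->
  knn_univ_consistent d k.
Proof.
move=> sepc small_dense x0 P.
set B := g_sigma_algebraType (@metric_open R (ptd x0) d).
have [mu muE] := @probability_pushforward _ B R _ _ P fst measurable_fst.
have V0 := null_part_null dm mu small_dense.
have sepS := support_separable dm mu.
have mV := measurable_null_part dm mu.
set V := null_part mu in V0 sepS mV.
have [x1 nV1] : exists x, (~` V) x.
  apply: contrapT => h; have : mu (~` V : set B) = 1%E.
    by rewrite probability_setC// V0 sube0.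
  rewrite (_ : ~` V = set0) ?measure0.
    by move/eqP; rewrite eq_sym onee_eq0.
  by apply/seteqP; split => // x Vx; apply: h; exists x.
pose s1 : {x | (~` V) x} := exist _ x1 nV1.
set BS := g_sigma_algebraType (@metric_open R (ptd s1) (sub_metric d (~` V))).
pose rho (x : B) : BS := if pselect ((~` V) x) is left h then exist _ x h else s1.
have rhoE x : ~ V x -> proj1_sig (rho x) = x by rewrite /rho; case: pselect.
have mrho : measurable_fun setT rho.
  move=> _ E' mE'; rewrite setTI; have [E mE ->] := borel_subspace_trace dm x0 mE'.
  rewrite (_ : _ @^-1` _ = (E `&` ~` V) `|` (V `&` [set _ | E x1])).
    apply: measurableU; first by apply: measurableI => //; exact: measurableC.
    have [Ex1|nEx1] := pselect (E x1).
      by rewrite (_ : [set _ | _] = setT) ?setIT//; apply/seteqP; split.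
    by rewrite (_ : [set _ | _] = set0) ?setI0//; apply/seteqP; split.
  apply/seteqP; split => x /=; rewrite /rho; case: pselect => [nVx|/contrapT Vx] /=.
  - by left.
  - by right.
  - by case=> [[]//|[]].
  - by case=> [[]//|[]].
have [|P' PE'] := @probability_pushforward _ (BorelLab (sub_metric d (~` V)) s1) R _ _ P
    (fun z => (rho z.1, z.2)).
  apply: measurable_fun_pair => /=; last exact: measurable_snd.
  exact: (measurableT_comp mrho measurable_fst).
apply/(knn_consistent_subspace dm sepS (P' := P')); last exact: sepc.
move=> A mA; pose f (z : B * bool) : B * bool := (proj1_sig (rho z.1), z.2).
have mf : measurable_fun setT f.
  apply: measurable_fun_pair => /=; last exact: measurable_snd.
  exact: (measurableT_comp (@measurable_sval R T d _ x0 s1) (measurableT_comp mrho measurable_fst)).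
transitivity (P (f @^-1` A)); last by rewrite PE'.
have mfA : measurable (f @^-1` A) by rewrite -[X in measurable X]setTI; exact: mf.
have mV' : measurable (fst @^-1` V : set (B * bool)).
  by rewrite -[X in measurable X]setTI; exact: measurable_fst.
have PV0 : P (fst @^-1` V) = 0%E by rewrite -[LHS]muE.
have key C : measurable C -> P C = P (C `\` fst @^-1` V).
  move=> mC; rewrite -[in LHS](setDUK (A := C `&` fst @^-1` V) (B := C)); last first.
    by move=> z [].
  rewrite measureU//; last 3 first.
  - exact: measurableI.
  - by apply: measurableD => //; exact: measurableI.
  - by rewrite setDE setICA setICr setI0.
  rewrite [X in (X + _)%E](_ : _ = 0%E) ?add0e; last first.
    apply/eqP; rewrite -measure_le0 -PV0; apply: le_measure; rewrite ?inE//.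
    exact: measurableI.
  by congr (P _); rewrite setDIr setDv set0U.
rewrite key// [RHS]key//; congr (P _); apply/seteqP; split => -[x y] [/= Ax nVx]; split => //.
  by rewrite /f/= rhoE.
by move: Ax; rewrite /f/= rhoE.
Qed.

End Sufficiency.

(** * Inconsistency from equidistributed distances *)

Lemma probability_rays_unique (R : realType) (m1 m2 : probability R R) :
  (forall r, m1 [set y | y < r] = m2 [set y | y < r]) ->
  forall A, measurable A -> m1 A = m2 A.
Proof.
move=> m12; refine (measure_unique (@RGenInftyO.G R) (fun n => `]-oo, n%:R[%classic) _ _ _ _ m1 m2 _ _).
- exact: RGenInftyO.measurableE.
- move=> _ _ [x ->] [y ->]; exists (Num.min x y).
  by apply/seteqP; split => z /=; rewrite !in_itv/= lt_min => /andP.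
- by move=> n; exists n%:R.
- apply/seteqP; split => // x _; exists (Num.truncn `|x|).+1 => //=.
  by rewrite in_itv/=; apply: le_lt_trans (ler_norm x) _; exact: truncnS_gt.
- by move=> _ [x ->]; rewrite set_itvE; exact: m12.
- by move=> n; rewrite ltey_eq fin_num_measure.
Qed.

Lemma metric_separated_measurable (R : realType) (T : Type) (d : T -> T -> R) (x0 : T)
    (W : set T) (eps : R) : is_metric d -> 0 < eps ->
  (forall x y, W x -> W y -> x <> y -> eps <= d x y) ->
  measurable (W : set (g_sigma_algebraType (@metric_open R (ptd x0) d))).
Proof.
move=> dm e0 sepW; apply: metric_closed_measurable => // y cl.
have [z Wz yz] := cl (eps / 2) (divr_gt0 e0 (ltr0Sn _ 1)).
suff -> : y = z by [].
apply: (metric_eq0 dm); apply/eqP; rewrite eq_le metric_ge0// andbT.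
apply/ler_addgt0Pr => e ep; rewrite add0r; have [|z' Wz'] := cl (Num.min e (eps / 2)).
  by rewrite lt_min ep divr_gt0.
rewrite lt_min => /andP[ye ye2]; suff -> : z = z' by exact: ltW.
apply: contrapT => ne; have := sepW _ _ Wz Wz' ne; have := metric_tri dm z y z'.
rewrite (metric_sym dm z y); lra.
Qed.

Lemma measurable_label_of_pairs (R : realType) k n (p : 'S_n) :
  measurable [set t : n.-tuple (R * bool) |
    label_of_keys k p (fun i => (tnth t i).1) (fun i => (tnth t i).2)].
Proof.
set A := [set t | _].
rewrite (_ : A = (fun t => label_of_keys k p (fun i => (tnth t i).1) (fun i => (tnth t i).2))
  @^-1` [set true]); last by apply/seteqP; split.
rewrite -[X in measurable X]setTI; apply: measurable_label_of_keys => // i.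
  apply: (measurableT_comp measurable_fst); exact: measurable_tnth.
apply: (measurableT_comp measurable_snd); exact: measurable_tnth.
Qed.

Section FlipSymmetry.
Local Open Scope ereal_scope.
Variables (R : realType) (Q : probability (R * bool)%type R).
Hypothesis flip : forall A : set (R * bool), measurable A ->
  Q A = Q ((fun z => (z.1, ~~ z.2)) @^-1` A).

(* Of a key sequence and its flipped version at least one is labelled [true]. *)
Lemma gprod_label_ge_half k n (p : 'S_n) : (k <= n)%N ->
  2^-1%:E <= gprod Q [set t | label_of_keys k p (fun i => (tnth t i).1) (fun i => (tnth t i).2)].
Proof.
move=> kn; set A := [set t | _].
have mA : measurable A by exact: measurable_label_of_pairs.
pose f (z : R * bool) := (z.1, ~~ z.2).
have mf : measurable_fun setT f.
  apply: measurable_fun_pair; first exact: measurable_fst.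
  by apply: measurable_neg; exact: measurable_snd.
have e1 := @gprod_pushforward _ _ _ _ _ Q Q f n A mf flip mA.
have e2 := gprod_setC Q mA.
have le : gprod Q (~` A) <= gprod Q A.
  rewrite [leRHS]e1; apply: gprod_le => t /= nA.
  have := label_of_keys_flip p (fun i => (tnth t i).1) (fun i => (tnth t i).2) kn.
  move=> /orP[//|]; rewrite /A /= => h.
  have e3 : (fun i => (tnth (map_tuple f t) i).1) = (fun i => (tnth t i).1).
    by apply/funext => i; rewrite tnth_map.
  have e4 : (fun i => (tnth (map_tuple f t) i).2) = (fun i => ~~ (tnth t i).2).
    by apply/funext => i; rewrite tnth_map.
  by rewrite e3 e4.
have : 1 <= gprod Q A + gprod Q A by rewrite -e2 leeD2l.
have := gprod_ge0 Q A; case: (gprod Q A) => [r| |]//.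
  by rewrite -EFinD !lee_fin => _ h; lra.
by move=> _ _; rewrite leey.
Qed.
End FlipSymmetry.

Section Inconsistent.
Variables (R : realType) (T : Type) (d : T -> T -> R) (k : nat -> nat).
Hypothesis dm : is_metric d.
Variables (I : Type) (i0 : I) (nu1 nu2 : probability (discr i0) R) (e : I -> T) (eps : R).
Variables (G E N : set I).
Hypotheses (eps0 : 0 < eps) (sepG : forall i j, G i -> G j -> i <> j -> eps <= d (e i) (e j)).
Hypotheses (G1 : nu1 (~` G) = 0%E) (G2 : nu2 (~` G) = 0%E).
Hypotheses (E1 : nu1 (~` E) = 0%E) (E2 : nu2 E = 0%E) (N2 : nu2 N = 0%E).
Hypothesis same_law : forall i, ~ N i -> forall r,
  nu1 [set j | d (e i) (e j) < r] = nu2 [set j | d (e i) (e j) < r].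
Local Notation x0 := (e i0).
Local Notation B := (g_sigma_algebraType (@metric_open R (ptd x0) d)).

(** [P] is the half-sum of [nu1] labelled 1 and [nu2] labelled 0. Almost surely the label is 1
    exactly at the points [e i] with [i] in both [E] and [G]; these form a closed set by separation,
    so the Bayes error is zero. *)
Lemma knn_inconsistent : (\forall n \near \oo, (k n <= n)%N) -> ~ knn_univ_consistent d k.
Proof.
move=> kn kc.
have [P1 P1E] := @probability_pushforward _ (BorelLab d x0) R _ _ nu1
  (fun i => (e i, true)) (@discr_measurable_fun I i0 _ (BorelLab d x0) setT _).
have [P2 P2E] := @probability_pushforward _ (BorelLab d x0) R _ _ nu2
  (fun i => (e i, false)) (@discr_measurable_fun I i0 _ (BorelLab d x0) setT _).
have mT2 : measure_add P1 P2 setT = (2%:R)%:E.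
  have h1 : P1 setT = 1%E by exact: probability_setT.
  have h2 : P2 setT = 1%E by exact: probability_setT.
  by rewrite measure_addE; transitivity (1 + 1 : \bar R)%E => //; congr (_ + _)%E.
have T0 : measure_add P1 P2 setT != 0%E by rewrite mT2 eqe pnatr_eq0.
have Toy : (measure_add P1 P2 setT < +oo)%E by rewrite mT2 ltry.
have [P PE] := @measure_condition_pushforward _ (BorelLab d x0) R _ _ (measure_add P1 P2) setT id
    measurableT T0 Toy (@measurable_id _ _ _).
have {}PE A : P A = ((nu1 [set i | A (e i, true)] + nu2 [set i | A (e i, false)]) * (2^-1)%:E)%E.
  have -> : P A = (measure_add P1 P2 (A `&` setT) * (fine (measure_add P1 P2 setT))^-1%:E)%E := PE A.
  by rewrite mT2 setIT measure_addE; congr (_ * _)%E; congr (_ + _)%E; [exact: P1E|exact: P2E].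
have cons := kc x0 P.
have msep (W : set I) : W `<=` G -> measurable (e @` W : set B).
  move=> WG; apply: (@metric_separated_measurable R T d x0 _ eps dm eps0) => _ _ [i Wi <-] [j Wj <-] ij.
  by apply: sepG; [exact: WG|exact: WG|move=> h; apply: ij; rewrite h].
have bayes0 : (bayes_err P <= 0)%E.
  apply: ereal_inf_lbound.
  exists (fun x : B => `[< (e @` (E `&` G)) x >]).
    apply: (measurable_fun_bool true); rewrite setTI.
    rewrite (_ : _ @^-1` _ = e @` (E `&` G)); first by apply: msep => i [].
    by apply/seteqP; split => x /=; [move/asboolP|move=> ?; apply/asboolP].
  rewrite PE /= [X in (X + _)%E](_ : _ = 0%E) ?add0e; last first.
    apply: (null_sub nu1 _ (null_setU nu1 _ _ E1 G1)) => i /=.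
    move=> h; apply: contrapT => /not_orP[/contrapT Ei /contrapT Gi].
    by move/negP : h; apply; apply/eqP/asboolP; exists i.
  rewrite [X in (X * _)%E](_ : _ = 0%E) ?mul0e//.
  apply: (null_sub nu2 _ (null_setU nu2 _ _ E2 G2)) => i /=.
  move=> h; have /asboolP[j [Ej Gj] ij] : `[< (e @` (E `&` G)) (e i) >] by move: h; case: `[< _ >].
  have [Gi|nGi] := pselect (G i); last by right.
  left; suff -> : i = j by [].
  apply: contrapT => ne; have := sepG Gi Gj ne; by rewrite ij (metric_refl dm) leNgt eps0.
have err n : (k n <= n)%N -> ((4^-1)%:E <= knn_err P k n)%E.
  move=> kn'; rewrite /knn_err.
  have h (p : 'S_n) : ((4^-1)%:E <= \int[P]_z @iprod _ _ _ _ P n [set s | knn_label d (k n) p s z.1 != z.2])%E.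
    (* Test points with label 0 outside the exceptional set: their mass is 1/2, and at each of them
       the rule answers 1 with probability at least 1/2. *)
    pose W : set (BorelLab d x0) := (e @` (G `\` N)) `*` [set false].
    have mW : measurable W.
      by apply: measurableX; [apply: msep => i []|].
    have PW : (P W = (2^-1)%:E)%E.
      rewrite PE (_ : [set i | W (e i, true)] = set0) ?measure0 ?add0e; last first.
        by apply/seteqP; split => // i [].
      rewrite [X in (X * _)%E](_ : _ = 1%E) ?mul1e//.
      transitivity (nu2 (~` (~` [set i | W (e i, false)]))); first by rewrite setCK.
      apply: null_setC.
      apply: (null_sub nu2 _ (null_setU nu2 _ _ G2 N2)) => i /= nW.
      have [Gi|nGi] := pselect (G i); last by left.
      right; apply: contrapT => nN; apply: nW; split => //=; by exists i.
    apply: (@le_trans _ _ (\int[P]_z ((2^-1)%:E * (\1_W z)%:E))%E).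
      rewrite ge0_integralZl//; last by apply/measurable_EFinP; exact: measurable_indic.
      have -> : (\int[P]_x (\1_W x)%:E = (2^-1)%:E)%E by rewrite integral_indic// setIT; exact: PW.
      by rewrite -EFinM lee_fin; lra.
    apply: ge0_le_integral_nomeas => z.
      by rewrite mule_ge0// lee_fin.
    rewrite indicE; case: (boolP (z \in W)) => [|_]; last first.
      by rewrite mule0 iprodE gprod_ge0.
    rewrite inE mule1; case: z => _ b [/= [i [Gi nN] <-] ->].
    rewrite iprodE; pose phi (w : BorelLab d x0) : R * bool := (d (e i) w.1, w.2).
    have mphi : measurable_fun setT phi.
      apply: measurable_fun_pair => /=; last exact: measurable_snd.
      exact: (measurableT_comp (@measurable_metric R T d x0 dm (e i)) measurable_fst).
    have [Q QE] := @probability_pushforward _ (R * bool)%type R _ _ P phi mphi.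
    (* Flipping exchanges the contributions of [nu1] and [nu2], whose laws of the distance from
       [e i] agree on rays and therefore on all Borel sets. *)
    have flip A : measurable A -> Q A = Q ((fun z => (z.1, ~~ z.2)) @^-1` A).
      move=> mA; rewrite !QE !PE /=; congr (_ * _)%E; rewrite addeC.
      have [L1 L1E] := @probability_pushforward _ R R _ _ nu1 (fun j => d (e i) (e j))
        (@discr_measurable_fun I i0 _ R setT _).
      have [L2 L2E] := @probability_pushforward _ R R _ _ nu2 (fun j => d (e i) (e j))
        (@discr_measurable_fun I i0 _ R setT _).
      have L12 := @probability_rays_unique R L1 L2.
      have {}L12 : forall A, measurable A -> L1 A = L2 A.
        by apply: L12 => r; rewrite L1E L2E; exact: same_law.
      have mAb b' : measurable [set r | A (r, b')].
        rewrite -[X in measurable X]setTI.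
        by apply: (measurable_fun_pair (f := id) (g := cst b')).
      have := L12 _ (mAb true); have := L12 _ (mAb false); rewrite !L1E !L2E => -> <-.
      by [].
    have := @gprod_label_ge_half _ Q flip (k n) n p kn'.
    move=> /le_trans; apply; rewrite (gprod_pushforward (P := P) mphi)//.
      apply: gprod_le => s /=; rewrite knn_labelE.
      rewrite (_ : (fun i => (tnth (map_tuple phi s) i).1) = (fun j => d (e i) (tnth s j).1)).
        rewrite (_ : (fun i => (tnth (map_tuple phi s) i).2) = (fun j => (tnth s j).2)).
          by move=> ->.
        by apply/funext => j; rewrite tnth_map.
      by apply/funext => j; rewrite tnth_map.
    exact: measurable_label_of_pairs.
  apply: (@le_trans _ _ ((n`!)%:R^-1%:E * \sum_(p : 'S_n) (4^-1)%:E)%E).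
    rewrite sumEFin sumr_const card_Sn -EFinM lee_fin -[X in _ * X]mulr_natl mulrA mulVf ?mul1r//.
  by apply: lee_wpmul2l; [rewrite lee_fin invr_ge0|apply: lee_sum => p _; exact: h].
have : ((4^-1)%:E <= bayes_err P)%E.
  rewrite -(cvg_lim _ cons)//; apply: lime_ge; first by apply/cvg_ex; exists (bayes_err P).
  by near=> n; apply: err; near: n.
by move=> /le_trans /(_ bayes0); rewrite lee_fin; lra.
Unshelve. all: by end_near.
Qed.

End Inconsistent.

(** * A weak Gitik-Shelah theorem *)

Section Sections.
Local Open Scope ereal_scope.
Context d1 d2 (X : measurableType d1) (Y : measurableType d2) (R : realType).
Variables (m1 : probability X R) (m2 : probability Y R).

Lemma integral_sections (E : set (X * Y)) : measurable E ->
  \int[m1]_x m2 (xsection E x) = \int[m2]_y m1 (ysection E y).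
Proof.
move=> mE; transitivity ((m1 \x m2) E) => //; transitivity ((m1 \x^ m2) E) => //.
by apply: product_measure_unique => // A B mA mB; exact: product_measure2E.
Qed.

(** By Tonelli's theorem the measure of [E] would be both at most 1/2 and at least 1. *)
Lemma sections_contra (E : set (X * Y)) (M : set Y) : measurable E ->
  (forall x, m2 (xsection E x) <= 2^-1%:E) ->
  measurable M -> m2 (~` M) = 0 -> (forall y, M y -> m1 (ysection E y) = 1) -> False.
Proof.
move=> mE small_x mM M0 full_y.
have h1 : \int[m1]_x m2 (xsection E x) <= 2^-1%:E.
  apply: (@le_trans _ _ (\int[m1]_x (2^-1%:E))).
    apply: ge0_le_integral => //; exact: measurable_fun_xsection.
  by rewrite integral_cst// [X in _ * X](_ : _ = 1) ?mule1//; exact: probability_setT.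
have h2 : 1 <= \int[m2]_y m1 (ysection E y).
  have h3 : m2 M = 1 by rewrite -(setCK M) probability_setC ?M0 ?sube0//; exact: measurableC.
  apply: (@le_trans _ _ (\int[m2]_y (\1_M y)%:E)).
    by rewrite integral_indic// setIT -[X in X <= _]h3.
  apply: ge0_le_integral => //.
  - by apply/measurable_EFinP; exact: measurable_indic.
  - exact: measurable_fun_ysection.
  - move=> y _; rewrite indicE; case: (boolP (y \in M)) => [|_]; last exact: measure_ge0.
    by rewrite inE => /full_y ->.
by move: (le_trans h2 (le_trans (eq_ind _ (fun z => z <= _) h1 _ (integral_sections mE)) (lexx _))); rewrite lee_fin; lra.
Qed.

Lemma null_ysections (E : set (X * Y)) (M : set X) : measurable E ->
  measurable M -> m1 (~` M) = 0 -> (forall x, M x -> m2 (xsection E x) = 0) ->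
  measurable [set y | m1 (ysection E y) != 0] /\ m2 [set y | m1 (ysection E y) != 0] = 0.
Proof.
move=> mE mM M0 E0.
have mZ : measurable [set y | m1 (ysection E y) != 0].
  have -> : [set y | m1 (ysection E y) != 0] = setT `&` (m1 \o ysection E) @^-1` (~` [set 0]).
    by rewrite setTI; apply/seteqP; split => y /= /eqP.
  by apply: (measurable_fun_ysection m1 mE) => //; apply: measurableC.
split => //.
have : \int[m2]_y m1 (ysection E y) = 0.
  rewrite -integral_sections//.
  have h : \int[m1]_(x in setT) `|(m2 \o xsection E) x| = 0.
    apply/(ae_eq_integral_abs m1 measurableT (measurable_fun_xsection m2 mE)).
    exists (~` M); split; [exact: measurableC|by []|].
    by move=> x /= nx Mx; apply: nx => _; exact: E0.
  by rewrite -[RHS]h; apply: eq_integral => x _; rewrite /= gee0_abs.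
move=> int0.
have : \int[m2]_(y in setT) `|(m1 \o ysection E) y| = 0.
  by rewrite -[RHS]int0; apply: eq_integral => y _; rewrite /= gee0_abs.
move=> /(ae_eq_integral_abs m2 measurableT (measurable_fun_ysection m1 mE)) [N [mN N0 sN]].
apply/eqP; rewrite -measure_le0 -[leRHS]N0; apply: le_measure; rewrite ?inE// => y /= y0.
by apply: sN => /= h; move/eqP: y0; apply; exact: h.
Qed.
End Sections.

Section DiscrLimits.
Local Open Scope ereal_scope.
Variables (R : realType) (S : Type) (s0 : S) (nu : probability (discr s0) R).

Lemma measure_geometric_union (F : nat -> set S) (e : R) : (0 <= e)%R ->
  (forall n, nu (F n) <= (e / (2 ^ n.+1)%:R)%:E) -> nu (\bigcup_n F n) <= e%:E.
Proof.
move=> e0 Fe; apply: (@le_trans _ _ (\sum_(n <oo) nu (F n))).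
  exact: (@measure_sigma_subadditive _ _ _ nu (\bigcup_n F n) F
    (fun=> discr_measurable s0 _) (discr_measurable s0 _) (@subset_refl _ _)).
have h : \sum_(n <oo) (e / (2 ^ n.+1)%:R)%:E <= e%:E.
  exact: (epsilon_trick0 xpredT).
by apply: le_trans h; apply: lee_nneseries => // n _ _; exact: Fe.
Qed.

Lemma vanishing_measure (F : nat -> set S) (e : R) : (0 < e)%R ->
  {homo F : n m / (n <= m)%N >-> m `<=` n} -> \bigcap_n F n = set0 -> exists n, nu (F n) <= e%:E.
Proof.
move=> e0 mF F0.
have fin0 : nu (F 0%N) < +oo by rewrite ltey_eq fin_num_measure.
have mono : {homo F : n m / (n <= m)%N >-> (n >= m)%O}.
  by move=> n m nm; apply/subsetPset; exact: mF.
have cv : nu (F n) @[n --> \oo] --> nu (\bigcap_n F n).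
  exact: (@nonincreasing_cvg_mu _ (discr s0) R nu F fin0 (fun _ => discr_measurable s0 _)
  (discr_measurable s0 _) mono).
move: cv; rewrite F0 measure0.
move=> /fine_cvgP[_ /cvgrPdist_le /(_ e e0)][n _ nP]; exists n.
have := nP n (leqnn n) => /=; rewrite sub0r normrN ger0_norm ?fine_ge0//.
by rewrite -lee_fin fineK// fin_num_measure.
Qed.
End DiscrLimits.

Lemma Forall_cat (A : Type) (P : A -> Prop) (s t : seq A) :
  List.Forall P (s ++ t) <-> List.Forall P s /\ List.Forall P t.
Proof.
elim: s => [|a s IH] /=; first by split=> [h|[]//]; split=> //; constructor.
rewrite !List.Forall_cons_iff IH; split=> [[h1 [h2 h3]]|[[h1 h2] h3]] //.
Qed.

(** * Outer regularity with respect to countable unions of cylinders *)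

Section Cylinders.
Local Open Scope ereal_scope.
Variables (R : realType) (S : Type) (s0 : S) (nu : probability (discr s0) R).
Variables (C : Type) (B : C -> set S) (Q : set C).

Definition cyl (l : seq (C * bool)) : set S :=
  [set x | List.Forall (fun cb : C * bool => B cb.1 x <-> cb.2) l].

Definition legal (l : seq (C * bool)) := List.Forall (fun cb => Q cb.1) l.

(** Presented by a sequence of codes, so that each term ranges over a small set when [Q] is small;
    the index set [P] allows the empty union. *)
Definition cylinder_union (U : set S) := exists (L : nat -> seq (C * bool)) (P : set nat),
  (forall k, legal (L k)) /\ U = \bigcup_(k in P) cyl (L k).

Lemma cylinder_union1 l : legal l -> cylinder_union (cyl l).
Proof.
move=> ll; exists (fun=> l), [set 0%N]; split => //.
by rewrite bigcup_set1.
Qed.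

Lemma cylinder_union0 : cylinder_union set0.
Proof.
exists (fun=> [::]), set0; split; first by move=> _; constructor.
by rewrite bigcup_set0.
Qed.

Lemma cylinder_unionT : cylinder_union setT.
Proof.
rewrite (_ : setT = cyl [::]); first by apply: cylinder_union1; constructor.
by apply/seteqP; split => // x _; constructor.
Qed.

Lemma cylinder_union_bigcup (U : nat -> set S) :
  (forall n, cylinder_union (U n)) -> cylinder_union (\bigcup_n U n).
Proof.
move=> /choice [L /choice [P OP]].
pose get (k : nat) : nat * nat := odflt (0, 0)%N (unpickle k).
exists (fun k => L (get k).1 (get k).2), [set k | P (get k).1 (get k).2].
split; first by move=> k; by have [lO _] := OP (get k).1; exact: lO.
apply/seteqP; split => [x [n _]|x [k Pk Ox]].
  have [_ ->] := OP n; move=> [m Pm Om]; by exists (pickle (n, m)); rewrite /= /get pickleK.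
by exists (get k).1 => //; have [_ ->] := OP (get k).1; exists (get k).2.
Qed.

Lemma cylinder_unionI U V : cylinder_union U -> cylinder_union V -> cylinder_union (U `&` V).
Proof.
move=> [L [P [lO ->]]] [L' [P' [lO' ->]]].
pose get (k : nat) : nat * nat := odflt (0, 0)%N (unpickle k).
exists (fun k => L (get k).1 ++ L' (get k).2), [set k | P (get k).1 /\ P' (get k).2].
split; first by move=> k; apply/Forall_cat; split; [exact: lO|exact: lO'].
apply/seteqP; split => [x [[n Pn On] [m Pm Om]]|x [k [Pk Pk'] /Forall_cat[h1 h2]]].
  have e : get (pickle (n, m)) = (n, m) by rewrite /get pickleK.
  by exists (pickle (n, m)); rewrite /= e //; apply/Forall_cat; split.
by split; [exists (get k).1|exists (get k).2].
Qed.

(** The condition is symmetric in [A] and its complement, hence stable under complements. For a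
    countable union, take all the [U n] but only finitely many [V n], since only finite
    intersections preserve unions of cylinders; what this omits has small measure by continuity of
    [nu]. *)
Lemma cylinder_regular (A : set S) : <<s [set B c | c in Q] >> A ->
  forall e : R, (0 < e)%R -> exists U V, [/\ cylinder_union U, cylinder_union V,
    A `<=` U, ~` A `<=` V & nu (U `&` V) <= e%:E].
Proof.
move: A; apply: smallest_sub; last first.
  move=> _ [c Qc <-] e e0; exists (cyl [:: (c, true)]), (cyl [:: (c, false)]); split.
  - by apply: cylinder_union1; constructor => //; constructor.
  - by apply: cylinder_union1; constructor => //; constructor.
  - by move=> x Bx; constructor => //; constructor.
  - by move=> x Bx; constructor => //; constructor.
  - rewrite (_ : _ `&` _ = set0) ?measure0 ?lee_fin ?ltW//.
    apply/seteqP; split => // x [h1 h2].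
    inversion h1 as [|? ? [_ h3] _]; inversion h2 as [|? ? [h4 _] _]; subst.
    by have := h4 (h3 erefl).
split.
- move=> e e0; exists set0, setT; split => //.
  + exact: cylinder_union0.
  + exact: cylinder_unionT.
  + by rewrite set0I measure0 lee_fin ltW.
- move=> A hA e e0; have [U [V [cU cV AU AV UV]]] := hA e e0.
  by exists V, U; split => //; rewrite ?setTD ?setCK// setIC.
- move=> A hA e e0.
  have /choice[U /choice[V UV]] n := hA n (e / 2 / (2 ^ n.+1)%:R)%R
    (ltac:(by rewrite !divr_gt0// ltr0n expn_gt0)).
  pose W := \bigcup_n (U n `&` V n).
  have We : nu W <= (e / 2)%:E.
    apply: measure_geometric_union; first by rewrite divr_ge0// ltW.
    by move=> n; have [_ _ _ _] := UV n.
  have [|||N Ne] := @vanishing_measure R S s0 nu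
     (fun N => \bigcup_n U n `\` \bigcup_(n in [set n | (n < N)%N]) U n) (e / 2).
  - by rewrite divr_gt0.
  - move=> n m nm x [Ux nUx]; split => // -[k /= kn Uk]; apply: nUx; exists k => //=.
    exact: leq_trans nm.
  - apply/seteqP; split => // x h; have [[n _ Un] _] := h 0%N Logic.I.
    by have [_] := h n.+1 Logic.I; apply; exists n => /=.
  have cV (M : nat) : cylinder_union [set x | forall n, (n < M)%N -> V n x].
    elim: M => [|M IH].
      by rewrite (_ : mkset _ = setT) ?cylinder_unionT//; [exact: cylinder_unionT|apply/seteqP; split].
    rewrite (_ : mkset _ = [set x | forall n, (n < M)%N -> V n x] `&` V M).
      by apply: cylinder_unionI => //; have [] := UV M.
    apply/seteqP; split => [x h|x [h hM] n].
      by split; [move=> n nM; apply: h; exact: ltnW|exact: h].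
    by rewrite ltnS leq_eqVlt => /orP[/eqP ->|] //; exact: h.
  exists (\bigcup_n U n), [set x | forall n, (n < N)%N -> V n x]; split => //.
  + by apply: cylinder_union_bigcup => n; have [] := UV n.
  + by move=> x [n _ An]; exists n => //; have [_ _ + _ _] := UV n; apply.
  + by move=> x nA n nN; have [_ _ _ + _] := UV n; apply => An; apply: nA; exists n.
  + rewrite (splitr e) EFinD.
    apply: le_trans (leeD Ne We); apply: le_trans (measureU2 _ _ _) => //.
    apply: le_measure; rewrite ?inE// => x [Ux Vx].
    have [[n /= nN Un]|nU] := pselect ((\bigcup_(n in [set n | (n < N)%N]) U n) x); last by left.
    by right; exists n => //; split => //; exact: Vx.
Qed.

End Cylinders.

Section SmallOrderFacts.
Local Open Scope ereal_scope.
Variables (R : realType) (S : Type) (s0 : S) (nu : probability (discr s0) R).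
Hypothesis dn : diffuse nu.

Lemma small_null (Q : set S) : small nu Q -> nu Q = 0.
Proof.
by move=> sQ; apply: (null_sub nu _ (smallP sQ (fun x => [set x]) (fun x _ => dn x))) => x Qx; exists x.
Qed.

(** Only countably many fibres are not null; the others are null and indexed by a small set, so
    their union is null. *)
Lemma small_fun_countable (I : Type) (Q : set I) (phi : S -> I) :
  small nu Q -> (forall x, Q (phi x)) ->
  exists (N : set S) (ka : nat -> I), nu N = 0 /\ forall x, ~ N x -> exists n, phi x = ka n.
Proof.
move=> sQ Qphi; pose D := [set q | nu (phi @^-1` [set q]) != 0].
have cD : countable D.
  apply: (@countable_disjoint_not_null _ (discr s0) R nu I D (fun q => phi @^-1` [set q])) => //.
  by move=> i j _ _ ij; apply/seteqP; split => // x [/= xi xj]; apply: ij; rewrite -xi.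
have [ka kaP] := countable_range (phi s0) cD.
exists (\bigcup_(q in Q `\` D) phi @^-1` [set q]), ka; split.
  apply: (smallP (small_sub _ sQ)); first by move=> q [].
  by move=> q [_ /negP]; rewrite negbK => /eqP.
move=> x nN; have Dx : D (phi x) by apply: contrapT => nD; apply: nN; exists (phi x).
by have [n nx] := kaP _ Dx; exists n.
Qed.

Variable lt : S -> S -> Prop.
Hypothesis so : small_order nu lt.

Lemma null_not_above x : nu [set y | ~ lt x y] = 0.
Proof.
have [_ _ tot sm] := so.
apply: (null_sub nu _ (null_setU nu _ _ (small_null (sm x)) (dn x))) => y /= nxy.
by have [//|->|] := tot x y; [right|left].
Qed.

Lemma above_sequence (g : nat -> S) : exists y, forall n, lt (g n) y.
Proof.
have h : nu (\bigcup_n [set y | ~ lt (g n) y]) = 0.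
  by apply: null_bigcup => n; exact: null_not_above.
have [y ny] : exists y, (~` (\bigcup_n [set y | ~ lt (g n) y])) y.
  by apply: (not_null_ex nu); rewrite null_setC// onee_neq0.
by exists y => n; apply: contrapT => nl; apply: ny; exists n.
Qed.

End SmallOrderFacts.

(** * Coding functions by approximating sets, and diagonalisation *)

Section Core.
Local Open Scope ereal_scope.
Variables (R : realType) (S : Type) (s0 : S) (nu : probability (discr s0) R).
Variable lt : S -> S -> Prop.
Hypotheses (so : small_order nu lt) (dn : diffuse nu).
Variables (C : Type) (B : C -> set S) (CG : S -> set C).
Hypotheses (CGsmall : forall g, small nu (CG g))
  (CGmono : forall g g', lt g g' -> CG g `<=` CG g') (CGex : forall c, exists g, CG g c).
Variable h : S -> nat -> bool.
Hypothesis h_null : forall t, nu [set x | h x = t] = 0.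
Hypothesis approx : forall (A : set S) (e : R), (0 < e)%R ->
  exists c, nu (A `\` B c `|` B c `\` A) <= e%:E.

Definition limsup_code (c : nat -> nat -> C) (x : S) : nat -> bool :=
  fun n => `[< forall M, exists2 m, (M <= m)%N & B (c n m) x >].

Lemma code_bound (c : nat -> nat -> C) : exists g, forall n m, CG g (c n m).
Proof.
have [gg ggP] : exists gg : nat -> nat -> S, forall n m, CG (gg n m) (c n m).
  by exists (fun n m => projT1 (cid (CGex (c n m)))) => n m; case: cid.
have [g gP] := above_sequence dn so (fun k => let nm := odflt (0, 0)%N (unpickle k) in gg nm.1 nm.2).
exists g => n m; apply: (CGmono _ (ggP n m)).
by have := gP (pickle (n, m)); rewrite pickleK.
Qed.

(** Borel-Cantelli: [B (c n m)] approximates the set where bit [n] is 1 with an error summable in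
    [m], so almost every point lies in finitely many of the errors and the upper limit recovers the
    bit. *)
Lemma limsup_code_represents (u : S -> nat -> bool) :
  exists c, nu [set x | limsup_code c x <> u x] = 0.
Proof.
have [c cP] : exists c : nat -> nat -> C, forall n m,
    nu ([set x | u x n] `\` B (c n m) `|` B (c n m) `\` [set x | u x n]) <= (1 / (2 ^ m.+1)%:R)%:E.
  have ex n m : exists c, nu ([set x | u x n] `\` B c `|` B c `\` [set x | u x n])
      <= (1 / (2 ^ m.+1)%:R)%:E.
    by apply: approx; rewrite divr_gt0// ltr0n expn_gt0.
  by exists (fun n m => projT1 (cid (ex n m))) => n m; case: cid.
exists c; pose F n m := [set x | u x n] `\` B (c n m) `|` B (c n m) `\` [set x | u x n].
have bad n : nu [set x | forall M, exists2 m, (M <= m)%N & F n m x] = 0.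
  apply/eqP; rewrite -measure_le0; apply/lee_addgt0Pr => e e0; rewrite add0e.
  have [M Me] : exists M : nat, (1 / (2 ^ M)%:R < e)%R.
    have [M Me] := ltr_add_invr e0; exists M; rewrite add0r in Me; apply: le_lt_trans Me.
    rewrite mul1r lef_pV2 ?posrE ?ltr0n ?expn_gt0// ler_nat; exact: ltn_expl.
  apply: (@le_trans _ _ (nu (\bigcup_k F n (M + k)%N))).
    apply: le_measure; rewrite ?inE// => x /(_ M)[m Mm Fm]; exists (m - M)%N => //.
    by rewrite subnKC.
  apply: (@le_trans _ _ (1 / (2 ^ M)%:R)%:E); last by rewrite lee_fin ltW.
  apply: measure_geometric_union => [|k]; first by rewrite divr_ge0.
  apply: le_trans (cP _ _) _; rewrite lee_fin -addnS expnD natrM invfM mulrA //.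
apply: (null_sub nu _ (null_bigcup nu _ bad)) => x /= ne; apply: contrapT => nb; apply: ne.
apply/funext => n; have [M MP] : exists M, forall m, (M <= m)%N -> ~ F n m x.
  apply: contrapT => nM; apply: nb; exists n => // M; apply: contrapT => nm; apply: nM.
  by exists M => m Mm Fm; apply: nm; exists m.
have {}MP m : (M <= m)%N -> B (c n m) x <-> u x n.
  move=> /MP nF; split=> [Bm|um]; first by apply: contrapT => nu'; apply: nF; right.
  by apply: contrapT => nB; apply: nF; left.
apply/idP/idP => [/asboolP /(_ M)[m Mm Bm]|un]; first by apply/(MP m Mm).
apply/asboolP => M'; exists (maxn M M'); first exact: leq_maxr.
by apply/(MP _ (leq_maxl _ _)).
Qed.

(** Replaces outer measure at most 1/2 for sets coded below [g]. The constant is positive, so that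
    null sets measurable over these codes are coverable, and below 1, so that [sections_contra]
    applies. *)
Definition coverable (g : S) (W : set S) :=
  exists U, [/\ cylinder_union B (CG g) U, W `<=` U & nu U <= (2^-1)%:E].

Lemma coverable_sub g W W' : W `<=` W' -> coverable g W' -> coverable g W.
Proof. by move=> WW' [U [cU W'U U2]]; exists U; split => // x /WW' /W'U. Qed.

(* Otherwise sections of measure at most 1/2 would cover a square up to a null set, against
   Tonelli; the legal codes form a small set, whence the joint measurability. *)
Lemma not_coverable_ex (g : S) (G : set S) (W : S -> set S) : nu (~` G) = 0 ->
  (forall x, G x -> nu [set g' | ~ W g' x] = 0) -> exists g', ~ coverable g (W g').
Proof.
move=> G0 GW; apply: contrapT => /forallNP cov.
have {cov} cov g' : exists LP : (nat -> seq (C * bool)) * set nat,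
    [/\ forall k, legal (CG g) (LP.1 k), W g' `<=` \bigcup_(k in LP.2) cyl B (LP.1 k) &
        nu (\bigcup_(k in LP.2) cyl B (LP.1 k)) <= (2^-1)%:E].
  have /contrapT [U [[L [P [lL ->]]] WU U2]] := cov g'.
  by exists (L, P).
have [LP LPP] : exists LP : S -> (nat -> seq (C * bool)) * set nat, forall g',
    [/\ forall k, legal (CG g) ((LP g').1 k), W g' `<=` \bigcup_(k in (LP g').2) cyl B ((LP g').1 k) &
        nu (\bigcup_(k in (LP g').2) cyl B ((LP g').1 k)) <= (2^-1)%:E].
  by exists (fun g' => projT1 (cid (cov g'))) => g'; case: cid.
have slegal : small nu (legal (CG g)).
  apply: small_seq; apply: (@small_sub _ _ _ nu _ _
    [set cb : C * bool | CG g cb.1 /\ [set: bool] cb.2]) => //.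
  by apply: small_pair => //; apply: small_countable.
have [N [ka NkaP]] : exists (N : nat -> set S) (ka : nat -> nat -> seq (C * bool)), forall k,
    nu (N k) = 0 /\ forall g', ~ N k g' -> exists n, (LP g').1 k = ka k n.
  have ex k : exists Nk : set S * (nat -> seq (C * bool)),
      nu Nk.1 = 0 /\ forall g', ~ Nk.1 g' -> exists n, (LP g').1 k = Nk.2 n.
    have [|N [ka Nka]] := small_fun_countable (fun g' => (LP g').1 k) slegal.
      by move=> g'; have [] := LPP g'.
    by exists (N, ka).
  exists (fun k => (projT1 (cid (ex k))).1), (fun k => (projT1 (cid (ex k))).2) => k.
  by case: cid.
pose NN := \bigcup_k N k.
have NN0 : nu NN = 0 by apply: null_bigcup => k; case: (NkaP k).
pose E : set (discr s0 * discr s0) := \bigcup_k \bigcup_n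
  ([set g' | [/\ ~ NN g', (LP g').2 k & (LP g').1 k = ka k n]] `*` cyl B (ka k n)).
have mE : measurable E.
  by apply: bigcupT_measurable => k; apply: bigcupT_measurable => n; apply: measurableX.
have EE g' x : E (g', x) <-> ~ NN g' /\ (\bigcup_(k in (LP g').2) cyl B ((LP g').1 k)) x.
  split=> [[k _ [n _ [/= [nN Pk e] cx]]]|[nN [k Pk cx]]].
    by split => //; exists k => //; rewrite e.
  have [|n e] := (NkaP k).2 g'; first by move=> Nk; apply: nN; exists k.
  by exists k => //; exists n => //; split => //=; rewrite -e.
apply: (@sections_contra _ _ (discr s0) (discr s0) R nu nu E G mE) => //.
- move=> g'; have [_ _ l2] := LPP g'; apply: le_trans l2.
  apply: le_measure; rewrite ?inE// => x; rewrite /xsection /= inE => /EE[] //.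
- move=> x Gx; rewrite -[ysection E x]setCK; apply: null_setC.
  apply: (null_sub nu _ (null_setU nu _ _ NN0 (GW x Gx))) => g' /= nE.
  have [NNg|nN] := pselect (NN g'); first by left.
  right=> Wx; apply: nE; rewrite /ysection /= inE; apply/EE; split => //.
  by have [_ + _] := LPP g'; apply.
Qed.

(** Seen through [h], the function is described by codes below [g], while the part of its graph in
    the square below [g'] is still too large to be covered by such codes. This square is small,
    which allows a pigeonhole argument. *)
Definition captured (g g' : S) (f : S -> S) := exists c : nat -> nat -> C,
  [/\ forall n m, CG g (c n m), nu [set x | limsup_code c x <> h (f x)] = 0 &
      ~ coverable g [set x | [/\ lt x g', lt (f x) g' & limsup_code c x = h (f x)]]].

(** A point where the code is right enters the set as soon as [g'] exceeds [x] and [f x], that is,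
    for almost all [g']; hence [not_coverable_ex] applies. *)
Lemma captured_ex (f : S -> S) : exists g g', captured g g' f.
Proof.
have [c cP] := limsup_code_represents (fun x => h (f x)); have [g gP] := code_bound c.
have [|x Gx|g' g'P] := @not_coverable_ex g [set x | limsup_code c x = h (f x)]
  (fun g' => [set x | [/\ lt x g', lt (f x) g' & limsup_code c x = h (f x)]]).
- exact: cP.
- apply: (null_sub nu _ (null_setU nu _ _ (null_not_above dn so x) (null_not_above dn so (f x)))).
  by move=> g' /= n3; apply: contrapT => /not_orP[/contrapT a /contrapT b]; apply: n3.
by exists g, g', c; split.
Qed.

(* Since [Z i] is null and measurable over the codes below [g], it is coverable; so [f i]
   captures a point [x i] outside [Z i].  The pairs [(x i, f i (x i))] range over a small set,
   hence one pair [(x, y)] serves a non-null set of [i], for all of which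
   [limsup_code (c i) x = h y]: this puts [x] in [Z i]. *)
Lemma no_captured_family g g' (f : S -> S -> S) : (forall i, captured g g' (f i)) ->
  (forall i j, i <> j -> nu [set x | h (f i x) = h (f j x)] = 0) -> False.
Proof.
move=> cap dif.
have [c cP] : exists c : S -> nat -> nat -> C, forall i,
    [/\ forall n m, CG g (c i n m), nu [set x | limsup_code (c i) x <> h (f i x)] = 0 &
      ~ coverable g [set x | [/\ lt x g', lt (f i x) g' & limsup_code (c i) x = h (f i x)]]].
  by exists (fun i => projT1 (cid (cap i))) => i; case: cid.
have [N [ka NkaP]] : exists (N : nat -> nat -> set S) (ka : nat -> nat -> nat -> C), forall n m,
    nu (N n m) = 0 /\ forall j, ~ N n m j -> exists k, c j n m = ka n m k.
  have ex n m : exists Nk : set S * (nat -> C),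
      nu Nk.1 = 0 /\ forall j, ~ Nk.1 j -> exists k, c j n m = Nk.2 k.
    have [|N [ka Nka]] := small_fun_countable (fun j => c j n m) (CGsmall g).
      by move=> j; have [] := cP j.
    by exists (N, ka).
  exists (fun n m => (projT1 (cid (ex n m))).1), (fun n m => (projT1 (cid (ex n m))).2) => n m.
  by case: cid.
pose NN := \bigcup_n \bigcup_m N n m.
have NN0 : nu NN = 0.
  by apply: null_bigcup => n; apply: null_bigcup => m; case: (NkaP n m).
(* The second factor carries only the sigma-algebra generated by the codes below [g]: then [Z i]
   belongs to it and is approximated by unions of cylinders over these codes. *)
pose Sg := g_sigma_algebraType ([set B c | c in CG g] : set (set (ptd s0))).
have [nug nugE] := @probability_pushforward _ Sg R _ (discr s0) nu id
  (@discr_measurable_fun S s0 _ Sg setT _).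
have mB c0 : CG g c0 -> measurable (B c0 : set Sg).
  by move=> gc; apply: sub_sigma_algebra; exists c0.
pose E i : set (discr s0 * Sg) := [set jx | ~ NN jx.1 /\ limsup_code (c jx.1) jx.2 = limsup_code (c i) jx.2].
have mE i : measurable (E i).
  (* Off the null set [NN], [c j n m] is one of the countably many [ka n m k]; this writes bit [n]
     of the code of [j] as a countable combination of rectangles. *)
  pose a n : set (discr s0 * Sg) := \bigcap_M \bigcup_(m in [set m | (M <= m)%N]) \bigcup_k
    ([set j | ~ NN j /\ c j n m = ka n m k] `*` B (ka n m k)).
  pose b n : set (discr s0 * Sg) := \bigcap_M \bigcup_(m in [set m | (M <= m)%N])
    (setT `*` B (c i n m)).
  have ma n : measurable (a n).
    apply: bigcapT_measurable => M; apply: bigcup_measurable => m _; apply: bigcupT_measurable => k.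
    have [[j [_ e]]|nex] := pselect (exists j, ~ NN j /\ c j n m = ka n m k).
      by apply: measurableX => //; apply: mB; rewrite -e; have [] := cP j.
    rewrite (_ : mkset _ = set0) ?set0X//.
    by apply/seteqP; split => // j hj; apply: nex; exists j.
  have mb n : measurable (b n).
    apply: bigcapT_measurable => M; apply: bigcup_measurable => m _.
    by apply: measurableX => //; apply: mB; have [] := cP i.
  have aE n j x : ~ NN j -> a n (j, x) <-> limsup_code (c j) x n.
    move=> nN; split=> [ax|/asboolP lx M _].
      apply/asboolP => M; have [m Mm [k _ [/= [_ e] Bx]]] := ax M Logic.I.
      by exists m => //; rewrite e.
    have [m Mm Bx] := lx M; exists m => //.
    have [|k e] := (NkaP n m).2 j; first by move=> Nj; apply: nN; exists n => //; exists m.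
    by exists k => //; split => //=; rewrite -e.
  have bE n j x : b n (j, x) <-> limsup_code (c i) x n.
    split=> [bx|/asboolP lx M _].
      by apply/asboolP => M; have [m Mm [_ /= Bx]] := bx M Logic.I; exists m.
    by have [m Mm Bx] := lx M; exists m.
  rewrite (_ : E i = ((~` NN) `*` setT) `&`
      \bigcap_n ((a n `&` b n) `|` (~` a n `&` ~` b n))); last first.
    apply/seteqP; split => -[j x].
      move=> [/= nN e]; split => // n _.
      have := aE n j x nN; have := bE n j x; rewrite e.
      case: (limsup_code (c i) x n) => -[b1 b2] [a1 a2].
        by left; split; [exact: a2|exact: b2].
      by right; split=> [/a1|/b1].
    move=> [[/= nN _] ab]; split => //=; apply/funext => n.
    have := aE n j x nN; have := bE n j x; case: (ab n Logic.I) => -[/= ax bx].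
      by move=> [/(_ bx) b1 _] [/(_ ax) a1 _]; rewrite a1 b1.
    move=> [_ b2] [_ a2]; apply/idP/idP => [/a2|/b2] //.
  apply: measurableI; first by apply: measurableX.
  apply: bigcapT_measurable => n; apply: measurableU; apply: measurableI => //;
    exact: measurableC.
pose Z i : set Sg := [set x | nu (ysection (E i) x) != 0].
have Zcov i : coverable g (Z i).
  have [||mZ Z0] := @null_ysections _ _ (discr s0) Sg R nu nug (E i) [set j | ~ NN j /\ j <> i] (mE i)
      (discr_measurable s0 _).
  - apply: (null_sub nu _ (null_setU nu _ _ NN0 (dn i))) => j /= nj.
    by apply: contrapT => /not_orP[a b]; apply: nj.
  - move=> j [nN ji]; rewrite nugE.
    have [_ ci0 _] := cP i; have [_ cj0 _] := cP j.
    apply: (null_sub nu _ (null_setU nu _ _ (null_setU nu _ _ ci0 cj0) (dif j i ji))) => x /=.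
    rewrite /xsection /= inE => -[_ /= e]; apply: contrapT.
    move=> /not_orP[/not_orP[/contrapT ei /contrapT ej] ne]; apply: ne.
    by rewrite -ei -ej e.
  have [||U [V [cU _ ZU ZV UV]]] := @cylinder_regular R S s0 nu C B (CG g) (Z i) _ (2^-1)%R.
  - exact: mZ.
  - by rewrite invr_gt0.
  exists U; split => //.
  have Z0' : nu (Z i) = 0 by rewrite -[RHS]Z0 nugE.
  apply: (@le_trans _ _ (nu (Z i `|` (U `&` V)))).
    apply: le_measure; rewrite ?inE// => x Ux.
    have [Zx|nZx] := pselect (Z i x); first by left.
    by right; split => //; exact: ZV.
  apply: le_trans (measureU2 _ _ _) _ => //.
  by rewrite -[leRHS]add0e; apply: leeD => //; rewrite measure_le0; apply/eqP; exact: Z0'.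
have pick i : exists x, [/\ lt x g', lt (f i x) g', limsup_code (c i) x = h (f i x) & ~ Z i x].
  apply: contrapT => /forallNP nx; have [_ _] := cP i; apply.
  apply: (coverable_sub _ (Zcov i)) => x [l1 l2 e]; apply: contrapT => nZ; exact: (nx x).
have [xx xxP] : exists xx : S -> S, forall i,
    [/\ lt (xx i) g', lt (f i (xx i)) g', limsup_code (c i) (xx i) = h (f i (xx i)) & ~ Z i (xx i)].
  by exists (fun i => projT1 (cid (pick i))) => i; case: cid.
have [_ _ _ sm] := so.
have [[x y] Ixy] : exists xy : S * S, nu [set i | xx i = xy.1 /\ f i (xx i) = xy.2] != 0.
  apply: contrapT => /forallNP all0.
  have := smallP (small_pair (sm g') (sm g')) (fun xy => [set i | xx i = xy.1 /\ f i (xx i) = xy.2]).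
  move=> hh; have : nu setT = 0.
    apply: (null_sub nu _ (hh _)); last by move=> xy _; apply/eqP/negPn/negP; exact: all0.
    move=> i _; exists (xx i, f i (xx i)); last by [].
    by have [l1 l2 _ _] := xxP i.
  by apply/eqP; exact: probT_neq0.
move/negP: Ixy; apply; apply/eqP => /=.
have [[i [[xi yi] ni]]|nex] := pselect (exists i, (xx i = x /\ f i (xx i) = y) /\ ~ NN i); last first.
  apply: (null_sub nu _ NN0) => i hi; apply: contrapT => ni; apply: nex; by exists i.
have [_ _ ei] := xxP i; rewrite /Z /= => /negP; rewrite negbK xi => /eqP Zx.
apply: (null_sub nu _ (null_setU nu _ _ NN0 Zx)) => j [xj yj].
have [Nj|nj] := pselect (NN j); [by left|right].
rewrite /ysection /= inE; split => //=.
have [_ _ ej _] := xxP j; move: ei ej; rewrite xi xj -[in f i x]xi yi -[in f j x]xj yj => -> ->.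
by [].
Qed.

(* A weak form of the Gitik-Shelah theorem.  By [no_captured_family], for every [(g, g')] some
   family [F g g'], indexed by a proper initial segment, is maximal among the families of
   captured functions whose images by [h] differ almost everywhere.  Diagonalising over all
   these families yields a function which is captured by no pair. *)
Lemma coded_sets_not_dense : False.
Proof.
have [wf tr tot sm] := so.
have ex g g' : exists f : S -> S -> S, forall f', captured g g' f' ->
    exists i, nu [set x | h (f' x) = h (f i x)] != 0.
  pose good i (f : S -> S -> S) j := captured g g' j /\
    forall y, lt y i -> nu [set x | h (j x) = h (f y x)] = 0.
  have [||x f f' j ff'|x f|f fP] := @wf_recursion S (S -> S) lt
     (fun i f j => (exists j', good i f j') -> good i f j).
  - exact: (inhabits id).
  - exact: wf.
  - have gE j' : good x f j' <-> good x f' j'.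
      split=> -[cj hj]; split => // y yx; first by rewrite -ff'//; exact: hj.
      by rewrite ff'//; exact: hj.
    by move=> H [j' /gE gj]; apply/gE; apply: H; exists j'.
  - have [[j gj]|ng] := pselect (exists j, good x f j); first by exists j.
    by exists id => /ng.
  (* A captured function differing almost everywhere from every [f i] would be an admissible choice
     at each stage, so the family would satisfy the hypotheses of [no_captured_family]. *)
  exists f => f' cf'; apply: contrapT => /forallNP nex.
  have allgood i : good i f (f i).
    apply: fP; exists f'; split => // y _; apply/eqP/negPn/negP; exact: nex.
  apply: (@no_captured_family g g' f).
    by move=> i; case: (allgood i).
  move=> i j ij; have [lij|//|lji] := tot i j.
    have [_ /(_ _ lij) e] := allgood j; rewrite -[RHS]e.
    by congr (nu _); apply/seteqP; split => x /=.
  by have [_ /(_ _ lji)] := allgood i.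
have [F FP] : exists F : S -> S -> S -> S -> S, forall g g' f', captured g g' f' ->
    exists i, nu [set x | h (f' x) = h (F g g' i x)] != 0.
  by exists (fun g g' => projT1 (cid (ex g g'))) => g g'; case: cid.
(* The values to avoid at [x] are indexed by triples below [x], a small set, and each excludes one
   fibre of [h], which is null. *)
have [f fP] : exists f : S -> S, forall x g g' i, lt g x -> lt g' x -> lt i x ->
    h (f x) <> h (F g g' i x).
  have exy x : exists y, forall g g' i, lt g x -> lt g' x -> lt i x -> h y <> h (F g g' i x).
    have := smallP (small_pair (sm x) (small_pair (sm x) (sm x)))
      (fun q => [set y | h y = h (F q.1 q.2.1 q.2.2 x)]).
    move=> hh; have U0 := hh (fun q _ => h_null _).
    have [y ny] : exists y, (~` (\bigcup_(q in [set q | lt q.1 x /\ (lt q.2.1 x /\ lt q.2.2 x)])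
        [set y | h y = h (F q.1 q.2.1 q.2.2 x)])) y.
      by apply: (not_null_ex nu); rewrite null_setC// onee_neq0.
    by exists y => g g' i gx g'x ix hy; apply: ny; exists (g, (g', i)).
  by exists (fun x => projT1 (cid (exy x))) => x; case: cid.
have [g [g' cap]] := captured_ex f.
have [i /negP] := FP g g' f cap; apply; apply/eqP.
apply: (null_sub nu _ (null_setU nu _ _ (null_setU nu _ _ (null_not_above dn so g)
  (null_not_above dn so g')) (null_not_above dn so i))) => x /= hx.
apply: contrapT => /not_orP[/not_orP[/contrapT gx /contrapT g'x] /contrapT ix].
exact: (fP x g g' i).
Qed.

End Core.

(** * Residues modulo a set of generators *)

Section DiscrIntegral.
Local Open Scope ereal_scope.
Variables (R : realType) (S : Type) (s0 : S) (nu : probability (discr s0) R).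
Implicit Types (u v : S -> R) (D : set S).

Definition bdd v := exists M : R, forall x, (`|v x| <= M)%R.

Lemma bdd_integrable v D : bdd v -> nu.-integrable (D : set (discr s0)) (EFin \o v).
Proof.
move=> [M vM]; apply: measurable_bounded_integrable => //.
  by rewrite ltey_eq fin_num_measure.
exists M; split; first exact: num_real.
by move=> r Mr x _; apply: le_trans (vM x) (ltW Mr).
Qed.

Lemma bddD u v : bdd u -> bdd v -> bdd (fun x => u x + v x)%R.
Proof.
move=> [M uM] [M' vM']; exists (M + M')%R => x.
by apply: le_trans (ler_normD _ _) _; exact: lerD.
Qed.

Lemma bddZ (a : R) v : bdd v -> bdd (fun x => a * v x)%R.
Proof.
move=> [M vM]; exists (`|a| * M)%R => x; by rewrite normrM ler_wpM2l.
Qed.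

Lemma bddB u v : bdd u -> bdd v -> bdd (fun x => u x - v x)%R.
Proof.
move=> [M uM] [M' vM']; exists (M + M')%R => x.
by apply: le_trans (ler_normB _ _) _; exact: lerD.
Qed.

Lemma bddM u v : bdd u -> bdd v -> bdd (fun x => u x * v x)%R.
Proof.
move=> [M uM] [M' vM']; exists (M * M')%R => x; rewrite normrM.
by apply: ler_pM.
Qed.

Lemma bdd_norm v : bdd v -> bdd (fun x => `|v x|)%R.
Proof. by move=> [M vM]; exists M => x; rewrite normr_id. Qed.

Lemma bdd_indic D : bdd (\1_D : S -> R).
Proof. by exists 1%R => x; rewrite indicE; case: (_ \in _); rewrite ?normr1 ?normr0. Qed.

(** Completeness for fast Cauchy sequences: the sum of the absolute increments gives an integrable
    bound, and dominated convergence yields the limit over every set. *)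
Lemma l1_limit (u : nat -> S -> R) (e : R) : (forall n, bdd (u n)) -> (0 <= e)%R ->
  (forall n, \int[nu]_x `|u n.+1 x - u n x|%:E <= (e / (2 ^ n.+1)%:R)%:E) ->
  exists f : S -> R, [/\ nu.-integrable (setT : set (discr s0)) (EFin \o f),
    (forall D : set (discr s0), \int[nu]_(x in D) (u n x)%:E @[n --> \oo] --> \int[nu]_(x in D) (f x)%:E) &
    \int[nu]_x `|u n x|%:E @[n --> \oo] --> \int[nu]_x `|f x|%:E].
Proof.
move=> bu e0 ue.
pose g (x : discr s0) := \sum_(n <oo) `|u n.+1 x - u n x|%:E.
have g0 x : 0 <= g x by apply: nneseries_ge0.
have gI : nu.-integrable setT g.
  apply/integrableP; split => //.
  apply: (@le_lt_trans _ _ e%:E); last by rewrite ltry.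
  rewrite (eq_integral g); last by move=> x _; rewrite gee0_abs.
  rewrite integral_nneseries//.
  apply: (@le_trans _ _ (\sum_(n <oo) (e / (2 ^ n.+1)%:R)%:E)).
    by apply: lee_nneseries => // n _ _; exact: integral_ge0.
  exact: (epsilon_trick0 xpredT).
pose hh (x : discr s0) := `|u 0%N x|%:E + g x.
have hI : nu.-integrable setT hh.
  by apply: integrableD => //; apply: bdd_integrable; exact: bdd_norm.
have uh x n : `|u n x|%:E <= hh x.
  rewrite (eq_sum_telescope (fun n => u n x) n).
  apply: (@le_trans _ _ (`|u 0%N x|%:E + \sum_(0 <= k < n) `|u k.+1 x - u k x|%:E)).
    rewrite sumEFin -EFinD lee_fin; apply: le_trans (ler_normD _ _) _.
    by rewrite lerD2l; exact: ler_norm_sum.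
  by apply: leeD2l; apply: nneseries_lim_ge => k _ _; rewrite lee_fin.
pose f (x : S) : R := limn (fun n => u n x).
have cvx x : g x \is a fin_num -> (u n x)%:E @[n --> \oo] --> (f x)%:E.
  move=> gx.
  apply/fine_cvgP; split; first by apply: nearW.
  pose t : R^nat := telescope (fun n => u n x).
  have : cvgn [normed series t]%R.
    apply: nondecreasing_is_cvgn.
      have E n : [normed series t]%R n = (\sum_(0 <= k < n) `|t k|)%R by [].
      by apply/nondecreasing_seqP => n; rewrite !E big_nat_recr//= lerDl.
    exists (fine (g x)) => _ [n _ <-]; rewrite -lee_fin fineK// /series /= -sumEFin.
    by apply: nneseries_lim_ge => k _ _; rewrite lee_fin.
  move=> /normed_cvg c.
  have : cvgn (fun n => u n x).
    rewrite (_ : (fun n => u n x) = (cst (u 0%N x) \+ series t)%R).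
      by apply: is_cvgD => //; exact: is_cvg_cst.
    by apply/funext => n; exact: (eq_sum_telescope (fun n => u n x)).
  by [].
have cv (D : set (discr s0)) : {ae nu, forall x, D x -> (u n x)%:E @[n --> \oo] --> (f x)%:E}.
  by have := integrable_ae measurableT gI; apply: filterS => x /(_ Logic.I) gx _; exact: cvx.
have fg (D : set (discr s0)) : {ae nu, forall x, forall n, D x -> `|(u n x)%:E| <= hh x}.
  by apply: aeW => x n _; exact: uh.
have mf v D : measurable_fun (D : set (discr s0)) (EFin \o v) by [].
have fI : nu.-integrable (setT : set (discr s0)) (EFin \o f).
  by have [] := dominated_convergence measurableT (fun n => mf (u n) setT) (mf f setT) (cv setT) hI (fg setT).
exists f; split=> //.
- move=> D.
  have hD : nu.-integrable D hh by exact: (integrableS measurableT).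
  by have [] := dominated_convergence (discr_measurable s0 D) (fun n => mf (u n) D) (mf f D) (cv D) hD (fg D).
- have cvn : {ae nu, forall x, setT x -> `|u n x|%:E @[n --> \oo] --> `|f x|%:E}.
    have := integrable_ae measurableT gI; apply: filterS => x /(_ Logic.I) /cvx ux _.
    exact: (cvg_abse ux).
  have fgn : {ae nu, forall x, forall n, setT x -> `| `|u n x|%:E | <= hh x}.
    by apply: aeW => x n _; rewrite /= normr_id; exact: uh.
  by have [] := dominated_convergence measurableT (fun n => mf (fun x => `|u n x|%R) setT)
    (mf (fun x => `|f x|%R) setT) cvn hI fgn.
Qed.
Lemma density_probability (w : S -> \bar R) : (forall x, 0 <= w x) ->
  \int[nu]_x w x != 0 -> \int[nu]_x w x < +oo ->
  exists Q : probability (discr s0) R,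
    forall D : set S, Q D = \int[nu]_(x in D) w x * (fine (\int[nu]_x w x))^-1%:E.
Proof.
move=> w0 I0 Ioo.
have Ige0 : 0 <= \int[nu]_x w x by exact: integral_ge0.
have Ifin : \int[nu]_x w x \is a fin_num by rewrite ge0_fin_numE.
apply: (@mkprob_ex _ (discr s0) R (fun D => \int[nu]_(x in D) w x * (fine (\int[nu]_x w x))^-1%:E)).
- by rewrite integral_set0 mul0e.
- by move=> A; rewrite mule_ge0 ?integral_ge0// lee_fin invr_ge0 fine_ge0.
- move=> F mF tF mUF.
  rewrite [X in X @ _ --> _](_ : _ = (fun n => \sum_(0 <= i < n) \int[nu]_(x in F i) w x) \*
      cst (fine (\int[nu]_x w x))^-1%:E); last first.
    by apply/funext => n; rewrite /= ge0_sume_distrl// => i _; exact: integral_ge0.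
  apply: cvgeZr => //; rewrite ge0_integral_bigcup//.
  by apply: is_cvg_nneseries => n _ _; exact: integral_ge0.
- by rewrite -{1}(fineK Ifin) -EFinM divff// fine_eq0.
Qed.

(** Where [f] has integral zero, its positive and negative parts have equal integrals. On the whole
    space this equates the two normalising constants, and on [D] the two measures. *)
Lemma signed_split (f : S -> R) : nu.-integrable (setT : set (discr s0)) (EFin \o f) ->
  \int[nu]_x (f x)%:E = 0 -> \int[nu]_x `|f x|%:E != 0 ->
  exists (nu1 nu2 : probability (discr s0) R) (E : set S),
  [/\ nu1 (~` E) = 0, nu2 E = 0, forall D, nu D = 0 -> nu1 D = 0, forall D, nu D = 0 -> nu2 D = 0 &
     forall D : set (discr s0), \int[nu]_(x in D) (f x)%:E = 0 -> nu1 D = nu2 D].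
Proof.
move=> fI f0 nf0; pose F : discr s0 -> \bar R := EFin \o f.
have parts (D : set (discr s0)) : \int[nu]_(x in D) (f x)%:E = 0 ->
    \int[nu]_(x in D) F^\+ x = \int[nu]_(x in D) F^\- x.
  rewrite integralE => h.
  have fin : \int[nu]_(x in D) F^\- x \is a fin_num.
    by apply: integrable_neg_fin_num => //; exact: (integrableS measurableT).
  by rewrite -[LHS](subeK _ fin) h add0e.
have eq := parts setT f0.
have Ip0 : \int[nu]_x F^\+ x != 0.
  apply/negP => /eqP h; move/negP: nf0; apply; apply/eqP.
  rewrite (_ : (fun x => `|f x|%:E) = (fun x => F^\+ x + F^\- x)); last first.
    by apply/funext => x; exact: (congr1 (fun g => g x) (fune_abse F)).
  by rewrite ge0_integralD// h add0e -eq.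
have Ip : \int[nu]_x F^\+ x < +oo.
  rewrite -ge0_fin_numE ?integral_ge0//; exact: integrable_pos_fin_num.
have [nu1 nu1E] := density_probability _ (funepos_ge0 F) Ip0 Ip.
have [||nu2 nu2E] := density_probability _ (funeneg_ge0 F).
- by rewrite -eq.
- by rewrite -eq.
exists nu1, nu2, [set x | 0 < f x]%R; split.
- rewrite nu1E integral0_eq ?mul0e// => x /= /negP; rewrite -leNgt => fx.
  by rewrite funeposE /F /= max_r// lee_fin.
- rewrite nu2E integral0_eq ?mul0e// => x /= fx.
  by rewrite funenegE /F /= max_r// lee_fin oppr_le0 ltW.
- by move=> D D0; rewrite nu1E null_set_integral ?mul0e.
- by move=> D D0; rewrite nu2E null_set_integral ?mul0e.
- by move=> D /parts h; rewrite nu1E nu2E h eq.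
Qed.

End DiscrIntegral.

Arguments bdd {R S} v.

Section BestApproximation.
Variables (R : realType) (S : Type) (s0 : S) (nu : probability (discr s0) R).
Variables (F : S -> rat -> set S).
Implicit Types (u v : S -> R) (D : set S) (c : seq (rat * option (S * rat))).

(** [None] codes the whole space, so that orthogonality to the generators includes mean zero. *)
Definition gen (o : option (S * rat)) : set S := if o is Some (i, q) then F i q else setT.

Definition phi c (x : S) : R := \sum_(ag <- c) ratr ag.1 * \1_(gen ag.2) x.

(** With threshold 1/2, [phi c] differs from the indicator of a set by at least 1/2 wherever
    [coded c] disagrees with that set. *)
Definition coded c : set S := [set x | 2^-1 < phi c x].

Local Notation Ex v := (\int[nu]_x v x)%R.

Let bI v : bdd v -> nu.-integrable (setT : set (discr s0)) (EFin \o v).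
Proof. exact: bdd_integrable. Qed.

Let ExD u v : bdd u -> bdd v -> Ex (fun x => u x + v x) = Ex u + Ex v.
Proof. by move=> bu bv; rewrite RintegralD//; exact: bI. Qed.

Let ExB u v : bdd u -> bdd v -> Ex (fun x => u x - v x) = Ex u - Ex v.
Proof. by move=> bu bv; rewrite RintegralB//; exact: bI. Qed.

Let ExZ (a : R) v : bdd v -> Ex (fun x => a * v x) = a * Ex v.
Proof. by move=> bv; rewrite RintegralZl//; exact: bI. Qed.

Let Ex_le u v : bdd u -> bdd v -> (forall x, u x <= v x) -> Ex u <= Ex v.
Proof. by move=> bu bv uv; apply: le_Rintegral => //; exact: bI. Qed.

Let Ex_cst (a : R) : Ex (fun=> a) = a.
Proof.
have h : nu setT = 1%E by exact: probability_setT.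
by rewrite Rintegral_cst//; transitivity (a * fine (1 : \bar R)%E); [rewrite -h|rewrite mulr1].
Qed.

Let EFin_Ex v : bdd v -> (\int[nu]_x (v x)%:E)%E = (Ex v)%:E.
Proof. by move=> bv; rewrite /Rintegral fineK//; apply: integrable_fin_num => //; exact: bI. Qed.

Let bdd_cst (a : R) : bdd (fun _ : S => a). Proof. by exists `|a|. Qed.

Let bdd_phi c : bdd (phi c).
Proof.
elim: c => [|[a g] c IH].
  by exists 0 => x; rewrite /phi big_nil normr0.
rewrite (_ : phi _ = (fun x => ratr a * \1_(gen g) x + phi c x)); last first.
  by apply/funext => x; rewrite /phi big_cons.
by apply: bddD => //; apply: bddZ; exact: bdd_indic.
Qed.

Let phi_cat c c' x : phi (c ++ c') x = phi c x + phi c' x.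
Proof. by rewrite /phi big_cat. Qed.

Let halve c := [seq (ag.1 / 2%:R, ag.2) | ag <- c].

Let phi_halve c x : phi (halve c) x = phi c x / 2.
Proof.
rewrite /phi /halve big_map mulr_suml; apply: eq_bigr => ag _ /=.
by rewrite rmorphM /= fmorphV /= rmorph_nat mulrAC.
Qed.

(* If [\1_A] is at positive distance from the span of the generators, its residue with respect
   to that span is a nonzero function orthogonal to all generators; the two measures are the
   normalised positive and negative parts of the residue. *)
Lemma not_approximable_split (A : set S) (de : R) : 0 < de ->
  (forall c, ~ (nu (A `\` coded c `|` coded c `\` A) <= de%:E)%E) ->
  exists (nu1 nu2 : probability (discr s0) R) (E : set S),
  [/\ nu1 (~` E) = 0%E, nu2 E = 0%E, forall D, nu D = 0%E -> nu1 D = 0%E,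
     forall D, nu D = 0%E -> nu2 D = 0%E & forall g, nu1 (gen g) = nu2 (gen g)].
Proof.
move=> de0 far.
pose w c x : R := \1_A x - phi c x.
have bw c : bdd (w c) by apply: bddB => //; exact: bdd_indic.
have bw2 c : bdd (fun x => w c x * w c x) by apply: bddM.
pose J c : R := Ex (fun x => w c x * w c x).
pose I : R := inf (range J).
have Jge0 c : 0 <= J c.
  by rewrite -[leLHS](Ex_cst 0); apply: Ex_le => // x; rewrite -expr2 sqr_ge0.
have Jlb : has_inf (range J).
  by split; [exists (J [::]), [::]|exists 0 => _ [c _ <-]].
have IJ c : I <= J c by apply: ge_inf; [exact: Jlb.2|exists c].
pose t n : R := 2^-1 ^+ n.
have t0 n : 0 < t n by rewrite exprn_gt0// invr_gt0.
have tS n : t n.+1 = t n / 2 by rewrite /t exprS mulrC.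
have [cc ccP] : exists cc : nat -> _, forall n, J (cc n) <= I + t n * t n.
  have ex n : exists c, J c <= I + t n * t n.
    have [_ [c _ <-] Jc] := inf_adherent (mulr_gt0 (t0 n) (t0 n)) Jlb.
    by exists c; exact: ltW.
  by exists (fun n => projT1 (cid (ex n))) => n; case: cid.
pose u n := w (cc n).
(* Parallelogram identity: the midpoint, coded by [c'], has square distance at least [I], and the
   two ends exceed [I] by at most [t n * t n]. *)
have par n : Ex (fun x => (u n.+1 x - u n x) * (u n.+1 x - u n x)) <= 4 * (t n * t n).
  set c' := halve (cc n.+1) ++ halve (cc n).
  have e x : (u n.+1 x - u n x) * (u n.+1 x - u n x) =
      (2 * (u n.+1 x * u n.+1 x) + 2 * (u n x * u n x)) - 4 * (w c' x * w c' x).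
    by rewrite /u /w /c' phi_cat !phi_halve; field.
  rewrite (_ : (fun x => _) = (fun x => (2 * (u n.+1 x * u n.+1 x) + 2 * (u n x * u n x)) -
      4 * (w c' x * w c' x))); last by apply/funext => x; exact: e.
  rewrite ExB; [|by apply: bddD; apply: bddZ; exact: bw2|by apply: bddZ; exact: bw2].
  rewrite ExD; [|by apply: bddZ; exact: bw2|by apply: bddZ; exact: bw2].
  rewrite !ExZ; [|exact: bw2|exact: bw2|exact: bw2].
  have := ccP n; have := ccP n.+1; have := IJ c'; rewrite tS -/(J _) -/(J _) -/(J _).
  by have := t0 n; nra.
(* By [|v| <= v^2 / (2 t) + t / 2] with [t = t n], the integral is at most [5 t / 2], which is
   [5 / 2^(n+1)]. *)
have cauchy n : (\int[nu]_x `|u n.+1 x - u n x|%:E <= (5 / (2 ^ n.+1)%:R)%:E)%E.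
  have bd : bdd (fun x => u n.+1 x - u n x) by apply: bddB; exact: bw.
  rewrite EFin_Ex; last exact: bdd_norm.
  rewrite lee_fin.
  apply: (@le_trans _ _ (Ex (fun x => (2 * t n)^-1 * ((u n.+1 x - u n x) * (u n.+1 x - u n x)) + t n / 2))).
    apply: Ex_le; first exact: bdd_norm.
      by apply: bddD => //; apply: bddZ; exact: bddM.
    move=> x; set v := u n.+1 x - u n x.
    have -> : v * v = `|v| * `|v| by rewrite -normrM ger0_norm// -expr2 sqr_ge0.
    rewrite -subr_ge0 (_ : _ - _ = (2 * t n)^-1 * (`|v| - t n) ^+ 2).
      by rewrite mulr_ge0 ?sqr_ge0// invr_ge0 mulr_ge0// ltW.
    by field; exact: lt0r_neq0.
  rewrite ExD//; last by apply: bddZ; exact: bddM.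
  rewrite Ex_cst ExZ; last exact: (bddM bd bd).
  have -> : 5 / (2 ^ n.+1)%:R = (2 * t n)^-1 * (4 * (t n * t n)) + t n / 2.
    rewrite natrX exprS invfM -exprVn -/(t n); field; exact: lt0r_neq0.
  by rewrite lerD2r ler_pM2l ?par// invr_gt0 mulr_gt0.
(* Adding the generator with coefficient [2^-n] or [-2^-n] cannot bring the square distance below
   [I]; since it was within [t n * t n] of [I], the scalar product is at most [t n] in absolute
   value. *)
have orth n g : `|Ex (fun x => u n x * \1_(gen g) x)| <= t n.
  have bg : bdd (\1_(gen g) : S -> R) by exact: bdd_indic.
  have Eg : Ex (fun x => \1_(gen g) x * \1_(gen g) x) <= 1.
    by rewrite -[leRHS](Ex_cst 1); apply: Ex_le => //; exact: (bddM bg bg).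
  have key (q : rat) : I <= J (cc n) - 2 * ratr q * Ex (fun x => u n x * \1_(gen g) x) +
      ratr q * ratr q * Ex (fun x => \1_(gen g) x * \1_(gen g) x).
    apply: le_trans (IJ ((q, g) :: cc n)) _; rewrite /J.
    rewrite (_ : (fun x => _) = (fun x => (u n x * u n x - 2 * ratr q * (u n x * \1_(gen g) x)) +
       ratr q * ratr q * (\1_(gen g) x * \1_(gen g) x))); last first.
      by apply/funext => x; rewrite /u /w /phi big_cons /=; ring.
    have bug : bdd (fun x => u n x * \1_(gen g) x) by exact: (bddM (bw _) bg).
    have bgg : bdd (fun x => \1_(gen g) x * \1_(gen g) x : R) by exact: (bddM bg bg).
    rewrite ExD; [|exact: (bddB (bw2 (cc n)) (bddZ _ bug))|exact: (bddZ _ bgg)].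
    rewrite ExB; [|exact: (bw2 (cc n))|exact: (bddZ _ bug)].
    rewrite (ExZ _ bug) (ExZ _ bgg).
    by rewrite lexx.
  have tq : ratr (2^-1 ^+ n : rat) = t n :> R by rewrite rmorphXn /= fmorphV /= rmorph_nat.
  have := key (2^-1 ^+ n); have := key (- 2^-1 ^+ n); rewrite rmorphN tq.
  have := ccP n; have tn := t0 n; move: Eg.
  set a := Ex (fun x => \1_(gen g) x * \1_(gen g) x); set b := Ex (fun x => u n x * \1_(gen g) x).
  move=> Eg h1 h2 h3; rewrite ler_norml.
  have h4 : t n * t n * a <= t n * t n by rewrite ler_piMr// mulr_ge0// ltW.
  by apply/andP; split; rewrite -(ler_pM2l tn); nra.
have bu n : bdd (u n) by exact: bw.
have ge05 : 0 <= 5 :> R by [].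
have [f [fI fD fabs]] := @l1_limit R S s0 nu u 5 bu ge05 cauchy.
have t_cvg : t n @[n --> \oo] --> 0.
  by apply: cvg_expr; rewrite ger0_norm ?invr_ge0// invf_lt1// ltr1n.
have fgen g : (\int[nu]_(x in (gen g : set (discr s0))) (f x)%:E)%E = 0%E.
  rewrite -(cvg_lim _ (fD (gen g)))//; apply: cvg_lim => //.
  have eq n : (\int[nu]_(x in (gen g : set (discr s0))) (u n x)%:E)%E =
      (Ex (fun x => u n x * \1_(gen g) x))%:E.
    rewrite -EFin_Ex; last by apply: bddM => //; exact: bdd_indic.
    by rewrite integral_mkcond; apply: eq_integral => x _; rewrite /patch indicE;
      case: (_ \in _); rewrite ?mulr1 ?mulr0.
  under eq_fun do rewrite eq.
  apply/cvg_EFin; first exact: nearW.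
  apply: (@squeeze_cvgr _ _ _ _ (fun n => - t n) t).
  - by apply: nearW => n; rewrite /= -ler_norml; exact: orth.
  - by rewrite -oppr0; exact: cvgN.
  - exact: t_cvg.
have f_neq0 : (\int[nu]_x `|f x|%:E)%E != 0%E.
  have : ((de / 2)%:E <= \int[nu]_x `|f x|%:E)%E.
    rewrite -(cvg_lim _ fabs)//; apply: lime_ge.
      by apply/cvg_ex; exists (\int[nu]_x `|f x|%:E)%E.
    apply: nearW => n; pose X := A `\` coded (cc n) `|` coded (cc n) `\` A.
    have Xde : (de%:E <= nu X)%E by apply: ltW; rewrite ltNge; apply/negP; exact: far.
    apply: (@le_trans _ _ (\int[nu]_x ((2^-1)%:E * (\1_X x)%:E)))%E.
      rewrite ge0_integralZl// integral_indic// setIT mulrC EFinM.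
      by apply: lee_wpmul2l; [rewrite lee_fin invr_ge0|exact: Xde].
    apply: ge0_le_integral => // x _; rewrite -EFinM lee_fin indicE.
    have [Xx|_] := boolP (x \in X); rewrite ?mulr0// mulr1 /u /w indicE.
    move: Xx; rewrite inE => -[[Ax nC]|[Cx nA]].
      rewrite mem_set//; move: nC; rewrite /coded /= => /negP; rewrite -leNgt => h.
      by apply: le_trans (ler_norm _); lra.
    rewrite memNset//; move: Cx; rewrite /coded /= => h.
    by rewrite sub0r normrN; apply: le_trans (ler_norm _); exact: ltW.
  apply: contraTN => /eqP ->; rewrite lee_fin -ltNge divr_gt0//.
have [|nu1 [nu2 [E [h1 h2 h3 h4 h5]]]] := @signed_split R S s0 nu f fI _ f_neq0.
  exact: (fgen None).
by exists nu1, nu2, E; split => // g; apply: h5; exact: fgen.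
Qed.
End BestApproximation.

Section Atomless.
Variables (R : realType) (S : Type) (s0 : S) (nu : probability (discr s0) R).

Definition atomless := forall E : set S, nu E != 0%E ->
  exists A, [/\ A `<=` E, nu A != 0%E & nu (E `\` A) != 0%E].

Let p (E : set S) : R := fine (nu E).

Let nuE E : nu E = (p E)%:E. Proof. by rewrite /p fineK// fin_num_measure. Qed.

Let p_ge0 E : 0 <= p E. Proof. exact: fine_ge0. Qed.

Let p_split E A : p E = p (E `&` A) + p (E `\` A).
Proof.
have : nu E = (nu (E `&` A) + nu (E `\` A))%E.
  by rewrite -measureU// ?setUIDK//; rewrite setIDA; apply/seteqP; split => x // -[[[_ h1] _] h2].
by rewrite !nuE => -[].
Qed.

Let p_le A E : A `<=` E -> p A <= p E.
Proof. by move=> AE; rewrite -lee_fin -!nuE; apply: le_measure; rewrite ?inE. Qed.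

Let p_neq0 E : nu E != 0%E -> 0 < p E.
Proof. by rewrite nuE eqe lt_neqAle p_ge0 andbT eq_sym. Qed.

Let bal (E A : set S) : R := Num.min (p (E `&` A)) (p (E `\` A)).

Let greedy_split : exists sp : set S -> set S, forall E A, bal E A <= 2 * bal E (sp E).
Proof.
have ex E : exists B, forall A, bal E A <= 2 * bal E B.
  have hs : has_sup (range (bal E)).
    split; first by exists (bal E set0), set0.
    exists (p E) => _ [A _ <-]; rewrite /bal ge_min; apply/orP; left; apply: p_le; exact: subIsetl.
  have [s0'|s0'] := leP (sup (range (bal E))) 0.
    exists set0 => A; apply: (@le_trans _ _ 0).
      by apply: le_trans s0'; apply: ub_le_sup; [case: hs|exists A].
    by rewrite mulr_ge0// /bal le_min !p_ge0.
  have [|_ [B _ <-] hB] := @sup_adherent _ _ (sup (range (bal E)) / 2) _ hs.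
    by rewrite divr_gt0.
  exists B => A; apply: (@le_trans _ _ (sup (range (bal E)))).
    by apply: ub_le_sup; [case: hs|exists A].
  by move: hB; lra.
by exists (fun E => projT1 (cid (ex E))) => E; case: cid.
Qed.

(* Splitting greedily, each cell into two parts whose smaller one is at least half as large as
   possible, leaves no non-null intersection of cells. *)
Lemma atomless_separating : atomless ->
  exists h : S -> nat -> bool, forall t, nu [set x | h x = t] = 0%E.
Proof.
move=> al; have [sp spP] := greedy_split.
pose cell := fix cell (x : S) (n : nat) : set S := if n is m.+1 then
  (if `[< sp (cell x m) x >] then cell x m `&` sp (cell x m) else cell x m `\` sp (cell x m))
  else setT.
pose h x n := `[< sp (cell x n) x >].
have cellS x n : cell x n.+1 = if h x n then cell x n `&` sp (cell x n) else cell x n `\` sp (cell x n).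
  by [].
have cellx x n : cell x n x.
  elim: n => // n IH; rewrite cellS; case: ifP => [/asboolP|/negbT/asboolP] hx //.
have cell_eq x y n : h x = h y -> cell x n = cell y n.
  by move=> hxy; elim: n => // n IH; rewrite !cellS hxy IH.
exists h => t; apply/eqP/negPn/negP => F0; have [A [AF A0 FA0]] := al _ F0.
have [x hx] := not_null_ex nu _ F0.
have Fcell n : [set x | h x = t] `<=` cell x n.
  by move=> y /= hy; rewrite (@cell_eq x y n) ?hx ?hy//; exact: cellx.
pose m := Num.min (p A) (p ([set x | h x = t] `\` A)).
have m0 : 0 < m by rewrite lt_min !p_neq0.
(* [A] splits every cell into two parts of measure at least [m], one containing [A] and the other
   the rest of the fibre; so the greedy split removes at least [m / 2]. *)
have step n : p (cell x n.+1) <= p (cell x n) - m / 2.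
  have h1 : m <= 2 * bal (cell x n) (sp (cell x n)).
    apply: le_trans (spP (cell x n) A); rewrite /bal /m.
    rewrite le_min; apply/andP; split.
      by rewrite ge_min; apply/orP; left; apply: p_le => y Ay; split => //; apply: Fcell; exact: AF.
    by rewrite ge_min; apply/orP; right; apply: p_le => y [Fy nA]; split => //; exact: Fcell.
  have h2 : bal (cell x n) (sp (cell x n)) <= p (cell x n `&` sp (cell x n)).
    by rewrite /bal ge_min lexx.
  have h3 : bal (cell x n) (sp (cell x n)) <= p (cell x n `\` sp (cell x n)).
    by rewrite /bal ge_min lexx orbT.
  have h4 := p_split (cell x n) (sp (cell x n)).
  by rewrite cellS; case: ifP => _; lra.
have bound n : p (cell x n) <= 1 - n%:R * (m / 2).
  elim: n => [|n IH].
    by rewrite mul0r subr0 /p /= (_ : nu setT = 1%E)//; exact: probability_setT.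
  by apply: le_trans (step n) _; rewrite -[n.+1%:R]natr1 mulrDl mul1r; lra.
pose n := (Num.truncn (2 / m)).+1.
have n1 : 2 / m < n%:R by exact: truncnS_gt.
have := bound n; have := p_ge0 (cell x n).
have : 1 < n%:R * (m / 2) by move: n1; rewrite ltr_pdivrMr// => n1; lra.
lra.
Qed.

End Atomless.

(** * The density bound *)

Section Necessity.
Variables (R : realType) (T : Type) (d : T -> T -> R) (k : nat -> nat).
Hypothesis dm : is_metric d.
Hypothesis kn : \forall n \near \oo, (k n <= n)%N.
Variables (I : Type) (i0 : I).

(** The generators are balls of rational radius; an increasing sequence of rationals tending to [r]
    and continuity from below give the other radii. *)
Lemma rational_rays (nu1 nu2 : probability (discr i0) R) (f : I -> R) :
  (forall q : rat, nu1 [set j | f j < ratr q] = nu2 [set j | f j < ratr q]) ->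
  forall r, nu1 [set j | f j < r] = nu2 [set j | f j < r].
Proof.
move=> nuq r.
have ex n : exists q : rat, r - n.+1%:R^-1 < ratr q < r - n.+2%:R^-1.
  have [|q] := @rat_in_itvoo R (r - n.+1%:R^-1) (r - n.+2%:R^-1).
    by rewrite ltrD2l ltrN2 ltf_pV2 ?posrE// ltr_nat.
  by rewrite in_itv /=; exists q.
have [q qP] := choice ex; pose F n := [set j | f j < ratr (q n)].
have ndF : {homo F : n m / (n <= m)%N >-> (n <= m)%O}.
  apply/nondecreasing_seqP => n; apply/subsetPset => j /= jq.
  have /andP[_ h1] := qP n; have /andP[h2 _] := qP n.+1.
  exact: lt_trans jq (lt_trans h1 h2).
have UF : \bigcup_n F n = [set j | f j < r].
  apply/seteqP; split=> [j [n _ /= jq]|j /= jr].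
    have /andP[_ h] := qP n; apply: lt_trans jq (lt_trans h _).
    by rewrite ltrBlDr ltrDl invr_gt0.
  have : 0 < r - f j by rewrite subr_gt0.
  move=> /ltr_add_invr[n]; rewrite add0r => nr; exists n => //=.
  have /andP[h _] := qP n; apply: lt_trans h; by rewrite ltrBrDr addrC -ltrBrDr.
have cv (nu : probability (discr i0) R) : nu (F n) @[n --> \oo] --> nu (\bigcup_n F n).
  exact: (@nondecreasing_cvg_mu _ (discr i0) R nu F (fun _ => discr_measurable i0 _)
    (discr_measurable i0 _) ndF).
rewrite -UF -(cvg_lim _ (cv nu1))// -(cvg_lim _ (cv nu2))//.
by congr (limn _); apply/funext => n; exact: nuq.
Qed.

(** For each rational ray, discard whichever of the ray and its complement is null. No rational
    separates the values at two remaining points. *)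
Lemma two_valued_constant (nu : probability (discr i0) R) (f : I -> R) :
  (forall A, nu A = 0%E \/ nu (~` A) = 0%E) -> exists c, nu [set x | f x <> c] = 0%E.
Proof.
move=> two.
pose N (q : rat) := if `[< nu [set x | f x < ratr q] = 0%E >] then [set x | f x < ratr q]
  else ~` [set x | f x < ratr q].
have N0 q : nu (N q) = 0%E.
  by rewrite /N; case: asboolP => // h; have [] := two [set x | f x < ratr q].
have NN : nu (\bigcup_q N q) = 0%E.
  have sr : small nu [set: rat] by apply: small_countable; exact: countableP.
  by apply: (smallP sr) => q _; exact: N0.
have [x0 nx0] : exists x, (~` \bigcup_q N q) x.
  by apply: (not_null_ex nu); rewrite null_setC// onee_neq0.
exists (f x0); apply: (null_sub nu _ NN) => x /= ne; apply: contrapT => nx.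
have lt_absurd a b : ~ (\bigcup_q N q) a -> ~ (\bigcup_q N q) b -> ~ f a < f b.
  move=> na nb /rat_in_itvoo[q]; rewrite in_itv /= => /andP[aq qb].
  have [aN|bN] : N q a \/ N q b; [|by apply: na; exists q|by apply: nb; exists q].
  rewrite /N; case: asboolP => _; [by left|right => /= bq; have := lt_trans qb bq; rewrite ltxx//].
by apply: ne; apply/eqP; rewrite eq_le !leNgt; apply/andP; split; apply/negP; exact: lt_absurd.
Qed.

Variables (e : I -> T) (eps : R) (G : set I).
Hypotheses (eps0 : 0 < eps) (sepG : forall i j, G i -> G j -> i <> j -> eps <= d (e i) (e j)).

(** From every [e i] the distance to almost every [e j] is a constant [ph i], and [ph] is almost
    everywhere a constant [rho]. If [ph a = rho], almost every [e i] is also at distance [rho] from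
    [e a], so [nu] and the point mass at [a] give the same law of distances. *)
Lemma inconsistent_two_valued (nu : probability (discr i0) R) : diffuse nu ->
  nu (~` G) = 0%E -> (forall A, nu A = 0%E \/ nu (~` A) = 0%E) -> ~ knn_univ_consistent d k.
Proof.
move=> dn G0 two.
have /choice[ph phP] i := two_valued_constant nu (fun j => d (e i) (e j)) two.
have [rho rhoP] := two_valued_constant nu ph two.
have [a /not_orP[/contrapT Ga /contrapT pha]] : exists a, (~` (~` G `|` [set x | ph x <> rho])) a.
  by apply: (not_null_ex nu); rewrite null_setC ?onee_neq0//; exact: null_setU.
pose dir : probability (discr i0) R := @dirac _ (discr i0) a R.
have dirE A : dir A = (\1_A a)%:E by [].
apply: (@knn_inconsistent R T d k dm I i0 dir nu e eps G [set a]
  ([set x | ph x <> rho] `|` [set j | d (e a) (e j) <> ph a]) eps0 sepG) => //.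
- by rewrite dirE indicE memNset//= => h; exact: h.
- by rewrite dirE indicE memNset//= => h; exact: h.
- exact: null_setU.
- move=> i /not_orP[/contrapT phi /contrapT ai] r; rewrite dirE.
  have dia : d (e i) (e a) = rho by rewrite (metric_sym dm) ai.
  have [rr|rr] := ltP rho r.
    rewrite indicE mem_set; last by rewrite /= dia.
    rewrite -(setCK [set j | d (e i) (e j) < r]) null_setC//.
    apply: (null_sub nu _ (phP i)) => j /= nr h; apply: nr; rewrite h phi//.
  rewrite indicE memNset; last by rewrite /= dia; apply/negP; rewrite -leNgt.
  apply/esym; apply: (null_sub nu _ (phP i)) => j /= jr h; move: jr; rewrite h phi.
  by rewrite ltNge rr.
Qed.

Lemma small_option (nu : probability (discr i0) R) (J : Type) (Q : set J) : small nu Q ->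
  small nu [set o : option J | if o is Some j then Q j else True].
Proof.
move=> sQ; apply: (@small_sub _ _ _ nu _ _
  (\bigcup_n (if n is 0%N then [set None] else Some @` Q))).
  by move=> [j|] /= h; [exists 1%N => //; exists j|exists 0%N].
by apply: small_bigcup => -[|n]; [exact: small_set1|exact: small_image].
Qed.

(** A code is a list of rational coefficients attached to balls of rational radius or to the whole
    space, and lies below [g] when all its centres do. *)
Lemma inconsistent_atomless (nu : probability (discr i0) R) (lt : I -> I -> Prop) :
  diffuse nu -> small_order nu lt -> nu (~` G) = 0%E -> atomless nu -> ~ knn_univ_consistent d k.
Proof.
move=> dn so G0 al; have [h hP] := atomless_separating al.
pose F (i : I) (q : rat) := [set j | d (e i) (e j) < ratr q].
pose below g (o : option (I * rat)) := if o is Some (i, q) then lt i g else True.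
pose CG g : set (seq (rat * option (I * rat))) :=
  [set c | List.Forall (fun ag => below g ag.2) c].
have [wf tr tot sm] := so.
have CGsmall g : small nu (CG g).
  suff sQ : small nu [set ag : rat * option (I * rat) | below g ag.2] by exact: (small_seq sQ).
  have s1 : small nu [set: rat] by apply: small_countable; exact: countableP.
  have s2 := small_option (small_pair (sm g) s1).
  apply: (small_sub _ (small_pair s1 s2)).
  by move=> [a [[i q]|]].
have CGmono g g' : lt g g' -> CG g `<=` CG g'.
  move=> gg' c; apply: List.Forall_impl => -[a [[i q]|]] //= ig; exact: tr gg'.
have CGex c : exists g, CG g c.
  elim: c => [|[a o] c [g gc]]; first by exists i0; constructor.
  (* The sequence contains the bound [g] of the tail and the new centre, so one strict bound serves
     both. *)
  have [g' g'P] := above_sequence dn so (fun n => if n is 0%N then g else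
    if o is Some (i, q) then i else i0).
  exists g'; constructor; last exact: (CGmono _ _ (g'P 0%N)).
  by have := g'P 1%N; case: (o) => [[i q]|].
have [A [de [de0 far]]] : exists (A : set I) (de : R), 0 < de /\
    forall c, ~ (nu (A `\` coded R F c `|` coded R F c `\` A) <= de%:E)%E.
  apply: contrapT => nex.
  apply: (@coded_sets_not_dense R I i0 nu lt so dn _ (coded R F) CG CGsmall CGmono CGex h hP).
  move=> A de de0; apply: contrapT => nc; apply: nex; exists A, de; split => // c hc.
  by apply: nc; exists c.
have [nu1 [nu2 [E [E1 E2 ac1 ac2 eqF]]]] := @not_approximable_split R I i0 nu F A de de0 far.
apply: (@knn_inconsistent R T d k dm I i0 nu1 nu2 e eps G E set0 eps0 sepG) => //.
- exact: ac1.
- exact: ac2.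
- move=> i _; apply: rational_rays => q; exact: (eqF (Some (i, q))).
Qed.

Lemma inconsistent_separated (nu : probability (discr i0) R) (lt : I -> I -> Prop) :
  diffuse nu -> small_order nu lt -> nu (~` G) = 0%E -> ~ knn_univ_consistent d k.
Proof.
move=> dn so G0; have [al|nal] := pselect (atomless nu).
  exact: (inconsistent_atomless dn so G0 al).
have [E [E0 atomE]] : exists E, nu E != 0%E /\
    forall A, A `<=` E -> nu A = 0%E \/ nu (E `\` A) = 0%E.
  apply: contrapT => nex; apply: nal => E E0; apply: contrapT => nA; apply: nex.
  exists E; split => // A AE; apply: contrapT => /not_orP[A1 A2]; apply: nA.
  by exists A; split => //; apply/eqP.
have Eoo : (nu E < +oo)%E by rewrite ltey_eq fin_num_measure.
have [nu' nu'E] := @measure_condition_pushforward _ (discr i0) R _ _ nu E id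
  (discr_measurable i0 E) E0 Eoo (@discr_measurable_fun I i0 _ (discr i0) E id).
have nu'0 A : nu (A `&` E) = 0%E -> nu' A = 0%E.
  by move=> h; rewrite nu'E /= h mul0e.
apply: (@inconsistent_two_valued nu').
- by move=> x; apply: nu'0; apply: (null_sub nu _ (dn x)) => y [].
- by apply: nu'0; apply: (null_sub nu _ G0) => y [].
- move=> A; have [h|h] := atomE (A `&` E) (@subIsetr _ _ _); [left|right]; apply: nu'0 => //.
  by apply: (null_sub nu _ h) => x [nA Ex]; split => // -[].
Qed.

End Necessity.

(** [D] is the union of maximal separated sets at countably many scales, so an injection into it
    puts a non-null set of indices into a single separated set. *)
Lemma small_dense_of_univ_consistent (R : realType) (T : Type) (d : T -> T -> R) (k : nat -> nat) :
  is_metric d -> (\forall n \near \oo, (k n <= n)%N) -> knn_univ_consistent d k ->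
  forall K : Type, real_valued_measurable R K ->
    exists D : set T, metric_dense d D /\ card_lt D [set: K].
Proof.
move=> dm kn cons K rvm; apply: contrapT => nD.
have [x0 [m dfm]] := rvm_probability rvm.
have mT : m (~` [set: K]) = 0%E by rewrite setCT measure0.
have [S [i0 [nu [lt [_ dnu so]]]]] := @small_order_extract R K x0 m setT dfm mT.
pose I := {x : K | S x}; rewrite -/I in i0 nu lt dnu so.
have [X XP] : exists X : nat -> set T, forall n,
    (forall x y, X n x -> X n y -> x <> y -> n.+1%:R^-1 <= d x y) /\
      forall w, exists2 x, X n x & d w x < n.+1%:R^-1.
  have ex n : exists X : set T,
    (forall x y, X x -> X y -> x <> y -> n.+1%:R^-1 <= d x y) /\
      forall w, exists2 x, X x & d w x < n.+1%:R^-1.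
    have [X [_ h2 h3]] := maximal_separated dm setT n.+1%:R^-1.
    by exists X; split => // w; exact: h3.
  by exists (fun n => projT1 (cid (ex n))) => n; case: cid.
pose D := \bigcup_n X n.
have denseD : metric_dense d D.
  move=> x r r0; have [n nr] := ltr_add_invr r0; rewrite add0r in nr.
  have [_ /(_ x)[y Xy xy]] := XP n; exists y; first by exists n.
  exact: lt_trans nr.
have [e [einj eD]] : exists e : I -> T, injective e /\ forall x, D (e x).
  (* If [K] does not inject into [D], no image of an initial segment covers [D] either, as this
     would make [D] strictly smaller than [K]; recursion then injects the indices. *)
  have [/card_leP[f]|KD] := pselect ([set: K] #<= D)%card.
    have KT (x : K) : x \in [set: K] by exact: mem_set.
    exists (fun x : I => val (f (exist _ (proj1_sig x) (KT _)))); split; last first.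
      by move=> x; exact: set_valP.
    move=> [x Sx] [y Sy] /= /val_inj fxy; have xy : x = y.
      have := @inj _ _ _ f _ _ (mem_set Logic.I) (mem_set Logic.I) fxy.
      by move=> /(congr1 val).
    by subst y; congr exist; exact: Prop_irrelevance.
  apply: (inject_not_covered so).
    apply/set0P/eqP => D0; apply: nD; exists D; split => //; split => //.
    by rewrite D0; exact: card_ge0.
  move=> f x cov; apply: nD; exists D; split => //; split => //.
  apply: (card_le_trans (subset_card_le cov)); apply: (card_le_trans (card_image_le _ _)).
  apply: (@card_le_trans _ _ _ [set: I]); first exact: subset_card_le.
  have inj : injective (fun x : I => proj1_sig x).
    by move=> [a Sa] [b Sb] /= ab; subst b; congr exist; exact: Prop_irrelevance.
  rewrite -(card_le_eql (inj_card_eq (f := fun x : I => proj1_sig x) _)); last by move=> a b _ _; exact: inj.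
  exact: subset_card_le.
have [n Xn0] : exists n, nu (e @^-1` X n) != 0%E.
  apply: contrapT => /forallNP all0.
  have : nu (\bigcup_n (e @^-1` X n)) = 0%E.
    by apply: null_bigcup => n; apply/eqP/negPn/negP; exact: all0.
  rewrite -preimage_bigcup (_ : _ @^-1` _ = setT); last first.
    by apply/seteqP; split => // x _; exact: eD.
  by apply/eqP; exact: probT_neq0.
have Xoo : (nu (e @^-1` X n) < +oo)%E by rewrite ltey_eq fin_num_measure.
have [nu' nu'E] := @measure_condition_pushforward _ (discr i0) R _ _ nu (e @^-1` X n) id
  (discr_measurable i0 _) Xn0 Xoo (@discr_measurable_fun I i0 _ (discr i0) _ id).
have nu'0 A : nu' A = 0%E <-> nu (A `&` e @^-1` X n) = 0%E.
  rewrite nu'E; split=> [/eqP|/= ->]; last by rewrite mul0e.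
  rewrite mule_eq0 => /orP[/eqP//|]; rewrite eqe invr_eq0 fine_eq0 ?fin_num_measure//.
  by rewrite (negbTE Xn0).
have so' : small_order nu' lt.
  have [wf tr tot sm] := so; split; [exact: wf|exact: tr|exact: tot|] => x; split=> N N0.
  apply/nu'0; have := smallP (sm x) (fun q => N q `&` e @^-1` X n).
  by rewrite -setI_bigcupl; apply => q qx; apply/nu'0; exact: N0.
apply: (@inconsistent_separated R T d k dm kn I i0 e n.+1%:R^-1 (e @^-1` X n) _ _ nu' lt) => //.
- move=> i j Xi Xj ij; have [sep _] := XP n; apply: sep => // eij; apply: ij; exact: einj.
- by move=> x; apply/nu'0; apply: (null_sub nu _ (dnu x)) => y [].
- by apply/nu'0; rewrite setICl measure0.
Qed.

Unset Implicit Arguments.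

Theorem mainTheorem1 (R : realType) (T : Type) (d : T -> T -> R) (k : nat -> nat) :
  is_metric d ->
  (forall M : nat, \forall n \near \oo, (M <= k n)%N) ->
  (fun n => (k n)%:R / n%:R : R) @ \oo --> (0 : R) ->
  knn_univ_consistent d k <->
  ((forall S : set T, metric_separable (sub_metric d S) ->
      knn_univ_consistent (sub_metric d S) k) /\
   (forall K : Type, real_valued_measurable R K ->
      exists D : set T, metric_dense d D /\ card_lt D [set: K])).
Proof.
move=> dm _ k0; split=> [cons|[sepc small_dense]]; last first.
  exact: knn_univ_consistent_of_separable_subspaces.
split; first by move=> S; exact: knn_univ_consistent_separable_subspace.
apply: small_dense_of_univ_consistent => //.
(* A ratio eventually below 1 gives [k n <= n], so that there are [k n] sample points to select. *)
move/cvgrPdist_lt : k0 => /(_ 1 ltr01) h; near=> n.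
have n0 : (0 < n)%N by near: n; exists 1%N.
have : `|0 - (k n)%:R / n%:R| < 1 :> R by near: n.
rewrite sub0r normrN ger0_norm ?divr_ge0// ltr_pdivrMr ?ltr0n// mul1r ltr_nat.
exact: ltnW.
Unshelve. all: by end_near.
Qed.
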